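(* Let $n>k\ge0$ be integers, $N=2^{n-k}$, $S=\{0,1,\dots,2N-1\}$, and let $\mathcal{H}_S=(\mathbb{C}^2)^{\otimes k}\otimes(\mathbb{C}^2)^{\otimes(n-k)}$ and $\mathcal{H}_A=(\mathbb{C}^2)^{\otimes(n-k+1)}$ (an ancilla of $n-k+1$ qubits). For $0<\varepsilon<1$ and $j\in\{0,\dots,N-1\}$ put $$K_j=\tfrac{1}{\sqrt{2N}}\,I^{\otimes k}\otimes\big(\sqrt{1-\varepsilon^2}\,I^{\otimes (n-k)}+i\varepsilon\sqrt{N}\,|\underline0\rangle\langle\underline j|\big),$$ $$K_{N+j}=\tfrac{1}{\sqrt{2N}}\,I^{\otimes k}\otimes\big(\sqrt{1-\varepsilon^2}\,I^{\otimes (n-k)}-i\varepsilon\sqrt{N}\,|\underline0\rangle\langle\underline j|\big).$$ Then the following hold. (1) $\{K_j\}_{j\in S}$ is a set of Kraus operators for the map $$\rho\mapsto(1-\varepsilon^2)\rho+\varepsilon^2\sum_{j=0}^{N-1}R_j\rho R_j^\dagger,\qquad R_j=I^{\otimes k}\otimes|\underline0\rangle\langle\underline j|.$$ (2) Let $K_j=U_{C,j}M_j$ be the polar decomposition ($U_{C,j}$ unitary, $M_j$ positive semidefinite). Up to second order in $\varepsilon$ (that is, with error $O(\varepsilon^3)$ as $\varepsilon\to0$), $$M_0=M_N=\tfrac{1}{\sqrt{2N}}I^{\otimes k}\otimes\Big[\big(1-\tfrac12\varepsilon^2\big)I^{\otimes(n-k)}+\tfrac N2\varepsilon^2|\underline0\rangle\langle\underline0|\Big],$$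 and for $j\in\{1,\dots,N-1\}$, with the upper sign for $M_j$ and the lower sign for $M_{N+j}$, $$\tfrac{1}{\sqrt{2N}}I^{\otimes k}\otimes\Big[\big(1-\tfrac12\varepsilon^2\big)I^{\otimes(n-k)}-\tfrac N8\varepsilon^2|\underline0\rangle\langle\underline0|+\tfrac{3N}{8}\varepsilon^2|\underline j\rangle\langle\underline j|\pm i\tfrac{\sqrt N}{2}\varepsilon\big(|\underline0\rangle\langle\underline j|-|\underline j\rangle\langle\underline0|\big)\Big].$$ For all $j\in\{0,\dots,N-1\}$, up to second order in $\varepsilon$, $U_{C,j}=e^{i\varepsilon H_{C,j}}$ and $U_{C,N+j}=e^{-i\varepsilon H_{C,j}}$, where $H_{C,j}=I^{\otimes k}\otimes\frac{\sqrt N}{2}\big(|\underline0\rangle\langle\underline j|+|\underline j\rangle\langle\underline0|\big)$. (3) Let $A_j=I^{\otimes k}\otimes(|\underline0\rangle\langle\underline j|+|\underline j\rangle\langle\underline0|)$ and $B_j=I^{\otimes k}\otimes(|\underline0\rangle\langle\underline j|-|\underline j\rangle\langle\underline0|)$ for $1\le j\le N-1$. Define operators $H_{j,l}$ ($j,l\in S$) on $\mathcal{H}_S$ as follows: $$H_{0,0}=-H_{N,N}=-\tfrac{2}{\sqrt N}\sum_{l=1}^{N-1}A_l,\qquad H_{0,N}=H_{N,0}=0;$$ for $1\le j\le N-1$, $$H_{0,j}=H_{j,0}=\tfrac{2}{\sqrt N}A_j,\quad H_{N,N+j}=H_{N+j,N}=-\tfrac{2}{\sqrt N}A_j,\quad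 H_{0,N+j}=H_{N+j,0}=H_{N,j}=H_{j,N}=0,$$ $$H_{j,j}=-H_{N+j,N+j}=\tfrac{2(1-N)}{\sqrt N}A_j,\qquad H_{j,N+j}=-H_{N+j,j}=\tfrac{\sqrt N}{2}B_j;$$ and for $1\le j\ne l\le N-1$, $$H_{j,l}=-H_{N+j,N+l}=\tfrac{1}{\sqrt N}(A_j+A_l),\qquad H_{j,N+l}=-H_{N+j,l}=\tfrac{1}{\sqrt N}(A_j-A_l).$$ Then $H_M=\sum_{j,l\in S}H_{j,l}\otimes|\underline j_a\rangle\langle\underline l_a|$ is Hermitian, and with $U_M=e^{i\varepsilon H_M}$ and $|A_0\rangle=|+\rangle^{\otimes(n-k+1)}$ one has, for every $|\psi\rangle\in\mathcal{H}_S$, up to second order in $\varepsilon$, $$U_M\big(|\psi\rangle\otimes|A_0\rangle\big)=\sum_{j\in S}M_j|\psi\rangle\otimes|\underline j_a\rangle .$$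
   Context: The vectors $|\underline j\rangle$, $0\le j\le 2^{n-k}-1$, are the standard (computational) basis vectors of $(\mathbb{C}^2)^{\otimes(n-k)}$, indexed by the integer $j$ via its binary representation. Likewise $|\underline j_a\rangle$, $0\le j\le 2^{n-k+1}-1$, are the standard basis vectors of the ancilla space $\mathcal{H}_A=(\mathbb{C}^2)^{\otimes(n-k+1)}$. $I$ is the identity on $\mathbb{C}^2$, and $|+\rangle=(|0\rangle+|1\rangle)/\sqrt2$, so $|A_0\rangle=\frac{1}{\sqrt{2N}}\sum_{j\in S}|\underline j_a\rangle$. ''Up to second order in $\varepsilon$'' means that the two sides differ by $O(\varepsilon^3)$ as $\varepsilon\to0$ with $n,k$ (and $|\psi\rangle$, where present) fixed. A set $\{K_j\}_{j\in S}$ is a set of Kraus operators for a map $\Phi$ if $\Phi(\rho)=\sum_{j\in S}K_j\rho K_j^\dagger$ for all $\rho$. Here $\mathcal{H}_S$ is the primary system of an $[[n,k,d]]$ stabilizer code, in a basis where the first $k$ qubits are information qubits and the last $n-k$ are syndrome qubits. The result gives a weak error-correction protocol: prepare the ancilla in $|A_0\rangle$, apply $U_M$, measure the ancilla in the basis $\{|\underline j_a\rangle\}$, and apply $U_{C,j}$ on outcome $j$. *)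

(* Defs.v *)
From mathcomp Require Import all_boot all_order all_algebra.
From mathcomp Require Import all_classical all_reals all_analysis.
From mathcomp Require Import complex mxtens.

Set Implicit Arguments.
Unset Strict Implicit.
Unset Printing Implicit Defensive.

Import Order.TTheory GRing.Theory Num.Theory numFieldNormedType.Exports.

Local Open Scope classical_set_scope.
Local Open Scope ring_scope.
Local Open Scope complex_scope.
Local Open Scope sesquilinear_scope.

(* R[i] packaged as a numClosedFieldType: with this sort as coefficient type,
   matrices get their topology and their (sup) norm by inference. *)
Definition Cx (R : realType) : numClosedFieldType := R[i].

Definition toC (R : realType) (x : R) : Cx R := x%:C.
Definition imC (R : realType) : Cx R := 'i.

Definition psdmx (C : numClosedFieldType) (d : nat) (A : 'M[C]_d) : Prop :=
  A \is hermsymmx /\ forall v : 'cV[C]_d, 0 <= (v ^t* *m A *m v) 0 0.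

Definition polar_decomposition (C : numClosedFieldType) (d : nat)
    (K U M : 'M[C]_d) : Prop :=
  [/\ U \is unitarymx, psdmx M & K = U *m M].

Definition kraus_operators (C : numClosedFieldType) (d r : nat)
    (K : nat -> 'M[C]_d) (Phi : 'M[C]_d -> 'M[C]_d) : Prop :=
  forall rho : 'M[C]_d, Phi rho = \sum_(j < r) K j *m rho *m (K j) ^t*.

Definition mexp (C : numClosedFieldType) (d : nat) (A : 'M[C]_d) : 'M[C]_d :=
  limn (series (fun m : nat => (m`!%:R)^-1 *: A ^+ m)).

(* e^{i eps H} *)
Definition expi (R : realType) (d : nat) (eps : R) (H : 'M[Cx R]_d) :
    'M[Cx R]_d :=
  mexp ((imC R * toC eps) *: H).

(* Equality up to second order as eps -> 0, eps > 0. *)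
Definition eq_2nd_order (R : realType) (p q : nat)
    (f g : R -> 'M[Cx R]_(p, q)) : Prop :=
  (fun eps => f eps - g eps) =O_ (0^'+) (fun eps : R => toC eps ^+ 3).

(* (C^2)^{(x) m} is identified with C^(2^m) by listing the standard basis in
   increasing order of the integers whose binary digits are the indices of the
   tensor factors.  Since mxtens_index (i, j) = i * q + j, the Kronecker product
   [_ *t _] is compatible with this.  Basis vectors are indexed by nat so that
   |0> needs no proof that the dimension is positive; ket d j = 0 if d <= j. *)
Definition ket (R : realType) (d j : nat) : 'cV[Cx R]_d :=
  \col_(a < d) (a == j :> nat)%:R.

Definition ketbra (R : realType) (d j l : nat) : 'M[Cx R]_d :=
  ket R d j *m (ket R d l) ^t*.

Definition ket_plus (R : realType) : 'cV[Cx R]_2 :=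
  (toC (Num.sqrt 2))^-1 *: (ket R 2 0 + ket R 2 1).

(* |+>^{(x) m}; the cast turns the number of columns 1 ^ m into 1. *)
Definition ket_plus_pow (R : realType) (m : nat) : 'cV[Cx R]_(2 ^ m) :=
  castmx (erefl _, exp1n m) (ntensmx (ket_plus R) m).

(* N = 2^(n-k) is the dimension of the syndrome space. *)
Definition dimN (n k : nat) : nat := (2 ^ (n - k))%N.
Definition dimS (n k : nat) : nat := (2 ^ k * dimN n k)%N.
Definition dimA (n k : nat) : nat := (2 ^ (n - k + 1))%N.

Definition sqrtN (R : realType) (n k : nat) : Cx R :=
  toC (Num.sqrt (dimN n k)%:R).
Definition sqrt2N (R : realType) (n k : nat) : Cx R :=
  toC (Num.sqrt (2 * dimN n k)%N%:R).

(* I^{(x) k} (x) X for an operator X on the syndrome qubits. *)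
Definition on_syndrome (R : realType) (n k : nat) (X : 'M[Cx R]_(dimN n k)) :
    'M[Cx R]_(dimS n k) :=
  (1%:M : 'M[Cx R]_(2 ^ k)) *t X.

Definition Rop (R : realType) (n k j : nat) : 'M[Cx R]_(dimS n k) :=
  on_syndrome (ketbra R (dimN n k) 0 j).

(* s = 1 gives K_j, s = -1 gives K_{N+j}. *)
Definition Kop_sgn (R : realType) (n k : nat) (s : Cx R) (eps : R) (j : nat) :
    'M[Cx R]_(dimS n k) :=
  (sqrt2N R n k)^-1 *: on_syndrome
    (toC (Num.sqrt (1 - eps ^+ 2)) *: 1%:M
     + (s * imC R * toC eps * sqrtN R n k) *: ketbra R (dimN n k) 0 j).

Definition Kop (R : realType) (n k : nat) (eps : R) (j : nat) :
    'M[Cx R]_(dimS n k) :=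
  if (j < dimN n k)%N then Kop_sgn n k 1 eps j
  else Kop_sgn n k (-1) eps (j - dimN n k)%N.

Definition recovery_map (R : realType) (n k : nat) (eps : R)
    (rho : 'M[Cx R]_(dimS n k)) : 'M[Cx R]_(dimS n k) :=
  toC (1 - eps ^+ 2) *: rho
  + toC (eps ^+ 2) *:
      \sum_(j < dimN n k) Rop R n k j *m rho *m (Rop R n k j) ^t*.

(* Second-order approximation of M_0 and M_N. *)
Definition Mapprox0 (R : realType) (n k : nat) (eps : R) :
    'M[Cx R]_(dimS n k) :=
  (sqrt2N R n k)^-1 *: on_syndrome
    ((1 - toC eps ^+ 2 / 2) *: 1%:M
     + ((dimN n k)%:R / 2 * toC eps ^+ 2) *: ketbra R (dimN n k) 0 0).

(* Second-order approximation of M_j (s = 1) and of M_{N+j} (s = -1),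
   for 1 <= j < N. *)
Definition Mapprox_sgn (R : realType) (n k : nat) (s : Cx R) (eps : R)
    (j : nat) : 'M[Cx R]_(dimS n k) :=
  let N := dimN n k in
  (sqrt2N R n k)^-1 *: on_syndrome
    ((1 - toC eps ^+ 2 / 2) *: 1%:M
     - (N%:R / 8 * toC eps ^+ 2) *: ketbra R N 0 0
     + (3 * N%:R / 8 * toC eps ^+ 2) *: ketbra R N j j
     + (s * imC R * (sqrtN R n k / 2) * toC eps) *:
         (ketbra R N 0 j - ketbra R N j 0)).

Definition HCop (R : realType) (n k j : nat) : 'M[Cx R]_(dimS n k) :=
  on_syndrome ((sqrtN R n k / 2) *:
    (ketbra R (dimN n k) 0 j + ketbra R (dimN n k) j 0)).

Definition Aop (R : realType) (n k j : nat) : 'M[Cx R]_(dimS n k) :=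
  on_syndrome (ketbra R (dimN n k) 0 j + ketbra R (dimN n k) j 0).
Definition Bop (R : realType) (n k j : nat) : 'M[Cx R]_(dimS n k) :=
  on_syndrome (ketbra R (dimN n k) 0 j - ketbra R (dimN n k) j 0).

(* H_{j,l} for 0 <= j, l < N. *)
Definition Hdiag (R : realType) (n k j l : nat) : 'M[Cx R]_(dimS n k) :=
  let N := dimN n k in
  let s := sqrtN R n k in
  if j == 0%N then
    if l == 0%N then - (2 / s) *: \sum_(1 <= m < N) Aop R n k m
    else (2 / s) *: Aop R n k l
  else if l == 0%N then (2 / s) *: Aop R n k j
  else if j == l then (2 * (1 - N%:R) / s) *: Aop R n k j
  else s^-1 *: (Aop R n k j + Aop R n k l).

(* H_{j,N+l} for 0 <= j, l < N. *)
Definition Hoff (R : realType) (n k j l : nat) : 'M[Cx R]_(dimS n k) :=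
  let s := sqrtN R n k in
  if (j == 0%N) || (l == 0%N) then 0
  else if j == l then (s / 2) *: Bop R n k j
  else s^-1 *: (Aop R n k j - Aop R n k l).

(* H_{j,l} for 0 <= j, l < 2N: in all cases H_{N+j,N+l} = - H_{j,l} and
   H_{N+j,l} = - H_{j,N+l}. *)
Definition Hop (R : realType) (n k j l : nat) : 'M[Cx R]_(dimS n k) :=
  let N := dimN n k in
  match (j < N)%N, (l < N)%N with
  | true, true => Hdiag R n k j l
  | true, false => Hoff R n k j (l - N)%N
  | false, true => - Hoff R n k (j - N)%N l
  | false, false => - Hdiag R n k (j - N)%N (l - N)%N
  end.

Definition HMop (R : realType) (n k : nat) :
    'M[Cx R]_(dimS n k * dimA n k)%N :=
  \sum_(j < (2 * dimN n k)%N) \sum_(l < (2 * dimN n k)%N)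
    Hop R n k j l *t ketbra R (dimA n k) j l.

Definition ancilla0 (R : realType) (n k : nat) : 'cV[Cx R]_(dimA n k) :=
  ket_plus_pow R (n - k + 1)%N.

(* Main.v *)
From HB Require Import structures.
Require Import Defs.
From mathcomp Require Import all_boot all_order all_algebra.
From mathcomp Require Import all_classical all_reals all_analysis.
From mathcomp Require Import complex mxtens.
From mathcomp Require Import ring lra.
Import Order.TTheory GRing.Theory Num.Theory numFieldNormedType.Exports.
Local Open Scope classical_set_scope.
Local Open Scope ring_scope.
Set Implicit Arguments.
Unset Strict Implicit.
Unset Printing Implicit Defensive.
Local Open Scope sesquilinear_scope.

(** The polar factors are controlled through second-order expansions
    [F0 + eps F1 + eps^2 F2 + O(eps^3)], which are stable under products and
    adjoints.  If [M] is positive semidefinite and [T = a I + O(eps)] is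
    Hermitian, then [D = M - T] satisfies
    [tr (D M D) + tr (D T D) = tr (D (M^2 - T^2))] with a nonnegative first
    term, so [M^2 - T^2 = O(eps^3)] forces [D = O(eps^3)]; here
    [M^2 = K^* K] is explicit.  The expansion of [U] then follows from
    [U M = K], since [M] is close to a multiple of the identity.  For the
    ancilla protocol, expanding [exp (i eps H_M)] reduces the claim to the row
    sums [h_j = \sum_l H_{j,l}] and [g_j = \sum_l H_{j,l} h_l], because the
    initial ancilla state is uniform. *)

(** * Positive semidefinite matrices and polar decompositions *)

(** No differentiability of matrix square roots is invoked. [M] and [U] are arbitrary functions of
    eps, and candidate Taylor polynomials are checked against [M^2 = K^* K] and [U M = K].
    Coefficient matching produces the candidates: the first-order part of [M] is the Hermitian part
    of that of [K], and [U] receives the rest. The scheme needs a nonzero scalar leading term in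
    [K], here [1 / sqrt (2N)]. The two signs in the Kraus operators are handled together through
    [z = s i sqrt N] with [s = 1] or [s = -1], so that [z^2 = - N] in both cases. The index 0 stays
    apart for an algebraic reason: [|0><0|] is a projector, while [|0><j|] squares to zero for
    [j > 0]. This is why [M_0] has no first-order term. Norms are entrywise sup norms with values in
    the complex numbers. Products and traces therefore cost dimension factors, which are constants
    here, and the inequalities are moved to the reals before any analysis. *)

Section Adjoint.
Variable C : numClosedFieldType.

Lemma adjmxE m n (A : 'M[C]_(m, n)) i j : (A ^t*) i j = (A j i)^*.
Proof. by rewrite !mxE. Qed.

Lemma adjmxM m n p (A : 'M[C]_(m, n)) (B : 'M[C]_(n, p)) :
  (A *m B) ^t* = B ^t* *m A ^t*.
Proof. by rewrite trmx_mul map_mxM. Qed.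

Lemma adjmxD m n (A B : 'M[C]_(m, n)) : (A + B) ^t* = A ^t* + B ^t*.
Proof. by rewrite linearD /= map_mxD. Qed.

Lemma adjmxN m n (A : 'M[C]_(m, n)) : (- A) ^t* = - A ^t*.
Proof. by rewrite linearN /= map_mxN. Qed.

Lemma adjmxZ m n c (A : 'M[C]_(m, n)) : (c *: A) ^t* = c^* *: A ^t*.
Proof. by rewrite linearZ /= map_mxZ. Qed.

Lemma adjmx0 m n : (0 : 'M[C]_(m, n)) ^t* = 0.
Proof. by rewrite trmx0 map_mx0. Qed.

Lemma adjmx1 n : (1%:M : 'M[C]_n) ^t* = 1%:M.
Proof. by rewrite trmx1 map_mx1. Qed.

Lemma adjmx_sum m n I (r : seq I) (P : pred I) (F : I -> 'M[C]_(m, n)) :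
  (\sum_(i <- r | P i) F i) ^t* = \sum_(i <- r | P i) (F i) ^t*.
Proof.
by apply: (big_morph (fun A : 'M[C]_(m, n) => A ^t*)); [exact: adjmxD|exact: adjmx0].
Qed.

Lemma hermsymmxP n (A : 'M[C]_n) : reflect (A ^t* = A) (A \is hermsymmx).
Proof.
by apply: (iffP (is_hermitianmxP _ _ _)); rewrite expr0 scale1r => /esym.
Qed.

Lemma adjmx_mul_ge0 n (v : 'cV[C]_n) : 0 <= (v ^t* *m v) 0 0.
Proof.
by rewrite mxE sumr_ge0// => i _; rewrite adjmxE mulrC mul_conjC_ge0.
Qed.

Lemma adjmx_mul_eq0 n (v : 'cV[C]_n) : (v ^t* *m v) 0 0 = 0 -> v = 0.
Proof.
rewrite mxE => /eqP.
rewrite psumr_eq0 => [/allP h|i _]; last by rewrite adjmxE mulrC mul_conjC_ge0.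
apply/colP => i; rewrite [RHS]mxE; apply/eqP.
have /= := h i (mem_index_enum i).
by rewrite adjmxE mulrC mul_conjC_eq0.
Qed.

End Adjoint.

Section PositiveSemidefinite.
Variables (C : numClosedFieldType) (d : nat).
Implicit Types A B D E K M T U : 'M[C]_d.

Lemma psdmx_congr (Q : 'M[C]_d) A : psdmx A -> psdmx (Q ^t* *m A *m Q).
Proof.
case=> /hermsymmxP hA posA; split=> [|v].
  by apply/hermsymmxP; rewrite !adjmxM trmxCK hA mulmxA.
by rewrite !mulmxA -adjmxM -!mulmxA mulmxA posA.
Qed.

Lemma psdmx_diag (s : 'rV[C]_d) : (forall i, 0 <= s 0 i) -> psdmx (diag_mx s).
Proof.
move=> s0; split=> [|v].
  apply/hermsymmxP/matrixP => i j; rewrite !mxE eq_sym.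
  by case: eqVneq => [->|_]; rewrite ?mulr0n ?rmorph0// mulr1n conj_Creal ?ger0_real.
rewrite mul_mx_diag mxE sumr_ge0// => i _.
by rewrite mxE adjmxE mulrAC mulr_ge0// mulrC mul_conjC_ge0.
Qed.

(** The spectral theorem diagonalizes [A] by a unitary [P]; the root is found by taking square roots
    of the eigenvalues. *)
Lemma psdmx_sqrt A : psdmx A -> exists2 B, psdmx B & B *m B = A.
Proof.
move=> [hA posA]; have /orthomx_spectralP := hermitian_normalmx hA.
set P := spectralmx A; set s := spectral_diag A => eA.
have uP : P \is unitarymx := spectral_unitarymx A.
rewrite (invmx_unitary uP) in eA.
have PPt : P *m P ^t* = 1%:M by apply/unitarymxP.
have PtP : P ^t* *m P = 1%:M by apply: mulmx1C.
(* Testing positivity on the eigenvector [P ^t* *m delta_mx i 0] returns the eigenvalue of index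
   [i]. *)
have s0 i : 0 <= s 0 i.
  have := posA (P ^t* *m delta_mx i 0); rewrite eA adjmxM trmxCK !mulmxA.
  rewrite -[_ *m P *m P ^t*]mulmxA PPt mulmx1 -[_ *m P *m P ^t*]mulmxA PPt mulmx1.
  rewrite trmx_delta map_delta_mx -rowE -colE !mxE.
  by rewrite eqxx mulr1n.
pose r : 'rV[C]_d := \row_i sqrtC (s 0 i).
exists (P ^t* *m diag_mx r *m P).
  by apply/psdmx_congr/psdmx_diag => i; rewrite mxE sqrtC_ge0.
rewrite !mulmxA -[_ *m P *m P ^t*]mulmxA PPt mulmx1.
rewrite -[_ *m diag_mx r *m diag_mx r]mulmxA mulmx_diag eA.
congr (_ *m diag_mx _ *m _); apply/rowP => i.
by rewrite !mxE -expr2 sqrtCK.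
Qed.

(** With [M = B^2] and [B] Hermitian, the quadratic form is the squared length of [B v]; hence [v]
    is in the kernel of [M]. *)
Lemma psdmx_definite M (v : 'cV[C]_d) :
  psdmx M -> M \in unitmx -> (v ^t* *m M *m v) 0 0 = 0 -> v = 0.
Proof.
move=> /psdmx_sqrt[B [/hermsymmxP hB _] eM] uM.
have -> : v ^t* *m M *m v = (B *m v) ^t* *m (B *m v).
  by rewrite adjmxM hB -eM !mulmxA.
move=> /adjmx_mul_eq0 Bv0; have : M *m v = 0 by rewrite -eM -mulmxA Bv0 mulmx0.
by move=> /(congr1 (mulmx (invmx M))); rewrite mulKmx// mulmx0.
Qed.

Lemma trace_adjmx_mul A D :
  \tr (D ^t* *m A *m D) = \sum_i ((col i D) ^t* *m A *m col i D) 0 0.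
Proof.
apply: eq_bigr => i _; rewrite !mxE; apply: eq_bigr => j _; rewrite !mxE.
by congr (_ * _); apply: eq_bigr => k _; rewrite !mxE.
Qed.

Lemma trace_psdmx_ge0 A D : psdmx A -> 0 <= \tr (D ^t* *m A *m D).
Proof. by case=> _ posA; rewrite trace_adjmx_mul sumr_ge0. Qed.

(** Without any commutation, [M^2 - T^2 = M D + D T]; cyclicity of the trace then turns [D D T] into
    [D T D]. *)
Lemma trace_sub_sqr M T : let D := M - T in
  \tr (D *m M *m D) + \tr (D *m T *m D) = \tr (D *m (M *m M - T *m T)).
Proof.
move=> D; rewrite (mxtrace_mulC (D *m T) D) -(mulmxA D M D) -linearD -mulmxDr /=.
by rewrite (mulmxBr M) (mulmxBl M T T) addrA subrK.
Qed.

(** Equal squares make two nonnegative traces add up to 0. Each column [v] of [M - T] then satisfies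
    [v^* T v = 0], and definiteness of [T] kills it. *)
Lemma psdmx_sqrt_unique M T :
  psdmx M -> psdmx T -> T \in unitmx -> M *m M = T *m T -> M = T.
Proof.
move=> pM pT uT eMT; have := trace_sub_sqr M T.
rewrite /= eMT subrr mulmx0 mxtrace0.
have hD : (M - T) ^t* = M - T.
  by case: pM pT => /hermsymmxP hM _ [/hermsymmxP hT _]; rewrite adjmxD adjmxN hM hT.
rewrite -{1 3}hD => /eqP.
rewrite paddr_eq0 ?trace_psdmx_ge0// => /andP[_].
rewrite trace_adjmx_mul psumr_eq0 => [/allP h|i _]; last by case: pT.
apply/eqP; rewrite -subr_eq0; apply/eqP/matrixP => i j.
have /= /eqP/(psdmx_definite pT uT)/colP/(_ i) := h j (mem_index_enum j).
by rewrite !mxE.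
Qed.

Lemma polar_sqr K U M : polar_decomposition K U M -> M *m M = K ^t* *m K.
Proof.
case=> uU [/hermsymmxP hM _] ->; rewrite adjmxM hM -mulmxA [_ *m (U *m _)]mulmxA.
by rewrite (mulmx1C (unitarymxP uU)) mul1mx.
Qed.

(** The positive factor must be the root of [K^* K]. It is invertible because [K] is, which forces
    [U = K M^-1], and [U^* U = M^-1 K^* K M^-1 = 1]. *)
Lemma polar_decomposition_exists_unique K : K \in unitmx ->
  exists! UM : 'M[C]_d * 'M[C]_d, polar_decomposition K UM.1 UM.2.
Proof.
move=> uK.
have pK : psdmx (K ^t* *m K).
  rewrite -[K ^t*]mulmx1; apply: psdmx_congr; split; first exact: hermitian1mx_subproof.
  by move=> v; rewrite mulmx1 adjmx_mul_ge0.
have unit_sqr M : M *m M = K ^t* *m K -> M \in unitmx.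
  move=> e; have : M *m M \in unitmx by rewrite e unitmx_mul uK andbT map_unitmx unitmx_tr.
  by rewrite unitmx_mul => /andP[].
have [M pM eM] := psdmx_sqrt pK.
have uM := unit_sqr _ eM.
have hM : M ^t* = M by apply/hermsymmxP; case: pM.
exists (K *m invmx M, M); split=> /=.
  split=> //; last by rewrite mulmxKV.
  apply/unitarymxP/mulmx1C; rewrite adjmxM -mulmxA [K ^t* *m _]mulmxA -eM.
  by rewrite mulmxK// -{2}hM -adjmxM mulmxV// adjmx1.
move=> [U' M'] /= pol'; have eM' := polar_sqr pol'.
case: pol' => _ pM' eK.
have e : M = M' by apply: psdmx_sqrt_unique => //; rewrite ?eM//; exact: unit_sqr.
by rewrite -e; congr pair; rewrite eK -e mulmxK.
Qed.

End PositiveSemidefinite.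

(** * The entrywise sup norm of complex matrices *)

Section MatrixNorm.
Variable C : numClosedFieldType.

Lemma ler_mx_norm_entry m n (A : 'M[C]_(m, n)) i j : `|A i j| <= `|A|.
Proof.
rewrite [leRHS]/Num.Def.normr /= mx_normE -[leLHS]nngE num_le.
exact: (le_bigmax _ _ (i, j)).
Qed.

Lemma mx_norm_ler m n (A : 'M[C]_(m, n)) c :
  0 <= c -> (forall i j, `|A i j| <= c) -> `|A| <= c.
Proof.
move=> c0 h; rewrite [leLHS]/Num.Def.normr /=.
have [->//|/mx_norm_neq0[[i j] ->]] := eqVneq (mx_norm A) 0.
exact: h.
Qed.

Lemma mx_norm_mul m n p (A : 'M[C]_(m, n)) (B : 'M[C]_(n, p)) :
  `|A *m B| <= n%:R * (`|A| * `|B|).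
Proof.
apply: mx_norm_ler => [|i j]; first by rewrite !mulr_ge0.
rewrite mxE (le_trans (ler_norm_sum _ _ _))//.
rewrite -[X in _ <= X%:R * _]card_ord -sumr_const mulr_suml.
by apply: ler_sum => k _; rewrite mul1r normrM ler_pM// ler_mx_norm_entry.
Qed.

Lemma mx_norm_adj m n (A : 'M[C]_(m, n)) : `|A ^t*| = `|A|.
Proof.
wlog suff h : m n A / `|A ^t*| <= `|A|.
  by apply/le_anti; rewrite h -{1}[A]trmxCK h.
by apply: mx_norm_ler => // i j; rewrite adjmxE norm_conjC ler_mx_norm_entry.
Qed.

Lemma mx_norm_trace n (A : 'M[C]_n) : `|\tr A| <= n%:R * `|A|.
Proof.
rewrite (le_trans (ler_norm_sum _ _ _))//.
rewrite -[X in _ <= X%:R * _]card_ord -sumr_const mulr_suml.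
by apply: ler_sum => k _; rewrite mul1r ler_mx_norm_entry.
Qed.

(** The trace is the squared Frobenius norm, a sum of nonnegative terms that contains the square of
    the largest entry. *)
Lemma mx_norm_sqr_le_trace m n (A : 'M[C]_(m, n)) : `|A| ^+ 2 <= \tr (A ^t* *m A).
Proof.
have tr0 i j : `|A i j| ^+ 2 <= \tr (A ^t* *m A).
  rewrite /mxtrace (bigD1 j)//= mxE (bigD1 i)//= adjmxE -addrA normCKC lerDl.
  rewrite addr_ge0 ?sumr_ge0// => k _; first by rewrite adjmxE -normCKC exprn_ge0.
  by rewrite mxE sumr_ge0// => l _; rewrite adjmxE -normCKC exprn_ge0.
have [A0|] := eqVneq (mx_norm A) 0.
  rewrite [`|A|]A0 expr0n /= sumr_ge0// => k _.
  by rewrite mxE sumr_ge0// => l _; rewrite adjmxE -normCKC exprn_ge0.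
by case/mx_norm_neq0 => -[i j] e; rewrite [`|A|]e tr0.
Qed.

End MatrixNorm.

(** * Second-order expansions *)

(** Quantitative version of the uniqueness of square roots. With [T = a + T'], the trace identity
    reads [a tr (D D) = tr (D E) - tr (D T' D) - tr (D M D)], and discarding the last term keeps an
    upper bound. Hermitian symmetry of [T] suffices, so a Taylor polynomial can serve as [T]. *)
Lemma psdmx_sqrt_stability (C : numClosedFieldType) d (a : C) (M T : 'M[C]_d) :
  0 <= a -> psdmx M -> T ^t* = T ->
  a * `|M - T| ^+ 2 <= d%:R ^+ 2 * (`|M - T| * `|M *m M - T *m T|)
                       + d%:R ^+ 3 * (`|M - T| ^+ 2 * `|T - a%:M|).
Proof.
move=> a0 pM hT; set D := M - T; set E := _ - T *m T; set T' := T - _.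
have hD : D ^t* = D.
  by case: pM => /hermsymmxP hM _; rewrite adjmxD adjmxN hM hT.
have tr0 : 0 <= a * \tr (D ^t* *m D).
  by rewrite mulr_ge0// (le_trans _ (mx_norm_sqr_le_trace _))// exprn_ge0.
have DMD := trace_psdmx_ge0 D pM.
have trE : a * \tr (D ^t* *m D)
    = \tr (D *m E) - \tr (D *m T' *m D) - \tr (D ^t* *m M *m D).
  have -> : \tr (D *m T' *m D) = \tr (D *m T *m D) - a * \tr (D *m D).
    by rewrite /T' (mulmxBr D T) mulmxBl linearB /= mul_mx_scalar -scalemxAl mxtraceZ.
  by rewrite -(trace_sub_sqr M T) -/D hD; ring.
have le1 : a * \tr (D ^t* *m D) <= \tr (D *m E) - \tr (D *m T' *m D).
  by rewrite trE gerBl.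
apply: (@le_trans _ _ (a * \tr (D ^t* *m D))).
  by rewrite ler_wpM2l// mx_norm_sqr_le_trace.
rewrite (le_trans le1)// -[leLHS]ger0_norm ?(le_trans tr0)//.
rewrite (le_trans (ler_normB _ _))// lerD//.
  rewrite (le_trans (mx_norm_trace _))// expr2 -mulrA ler_wpM2l//.
  exact: mx_norm_mul.
rewrite (le_trans (mx_norm_trace _))// !exprS !expr0 !mulr1 -!mulrA.
rewrite ler_wpM2l// (le_trans (mx_norm_mul _ _))// ler_wpM2l//.
have -> : d%:R * (`|D| * (`|D| * `|T'|)) = d%:R * (`|D| * `|T'|) * `|D| by ring.
by rewrite ler_wpM2r// mx_norm_mul.
Qed.

Lemma mulmx_quadratic (C : comNzRingType) p q t (x : C) (F0 F1 F2 : 'M[C]_(p, q))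
    (G0 G1 G2 : 'M[C]_(q, t)) :
  (F0 + x *: F1 + x ^+ 2 *: F2) *m (G0 + x *: G1 + x ^+ 2 *: G2)
  = F0 *m G0 + x *: (F0 *m G1 + F1 *m G0)
      + x ^+ 2 *: (F0 *m G2 + F1 *m G1 + F2 *m G0)
    + (x ^+ 3 *: (F1 *m G2 + F2 *m G1) + x ^+ 4 *: (F2 *m G2)).
Proof.
rewrite !mulmxDl !mulmxDr -!scalemxAl -!scalemxAr !scalerA.
move: (F0 *m G0) (F0 *m G1) (F1 *m G0) (F0 *m G2) (F1 *m G1) (F2 *m G0) => a b c a' b' c'.
move: (F1 *m G2) (F2 *m G1) (F2 *m G2) => a'' b'' c''.
by apply/matrixP => i j; rewrite !mxE; ring.
Qed.

HB.instance Definition _ (R : realType) :=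
  GRing.RMorphism.copy (@toC R) (real_complex R).

Section ToC.
Variable R : realType.

Lemma toC_le (x y : R) : (toC x <= toC y) = (x <= y).
Proof. exact: lecR. Qed.

Lemma toC_ge0 (x : R) : (0 <= toC x) = (0 <= x).
Proof. exact: ler0c. Qed.

Lemma toC_norm (x : R) : `|toC x| = toC `|x|.
Proof. by rewrite normc_def /= expr0n addr0 sqrtr_sqr. Qed.

Lemma conj_toC (x : R) : (toC x)^* = toC x.
Proof. by rewrite conj_Creal// complex_real. Qed.

(** Gateway to the reals: norms live in [Cx R], whose order is partial, and each is replaced by a
    real number before it is estimated. *)
Lemma ge0_toC (z : Cx R) : 0 <= z -> exists2 x : R, 0 <= x & z = toC x.
Proof.
move=> z0; have /complex_realP[x zx] : (z : R[i]) \is Num.real by exact: ger0_real.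
by exists x => //; rewrite -toC_ge0 -[toC x]zx.
Qed.

Lemma mx_norm_toC p q (A : 'M[Cx R]_(p, q)) : exists2 x : R, 0 <= x & `|A| = toC x.
Proof. exact: ge0_toC. Qed.

End ToC.

Section Expansions.
Variable R : realType.

Definition bigO_eps (r p q : nat) (f : R -> 'M[Cx R]_(p, q)) : Prop :=
  exists2 c : R, 0 <= c & \forall e \near 0^'+, `|f e| <= toC (c * e ^+ r).

Lemma near0_itv : \forall e \near (0 : R)^'+, 0 < e < 1.
Proof.
have h1 := nbhs_right_gt (0 : R); have h2 := nbhs_right_lt (ltr01 : (0 : R) < 1).
by apply: filterS2 h1 h2 => e -> ->.
Qed.

Lemma eq_2nd_orderP p q (f g : R -> 'M[Cx R]_(p, q)) :
  bigO_eps 3 (fun e => f e - g e) -> eq_2nd_order f g.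
Proof.
(* The constant has to be positive here, whereas [c] may be 0. *)
case=> c c0 fg; apply/eqO_exP; exists (toC (c + 1)).
  by rewrite lt0r toC_ge0 addr_ge0// andbT fmorph_eq0 gt_eqF// ltr_wpDl.
apply: filterS2 fg near0_itv => e fge /andP[e0 _].
rewrite (le_trans fge)// -rmorphXn toC_norm -rmorphM toC_le /=.
by rewrite normrX gtr0_norm// ler_wpM2r ?lerDl// exprn_ge0// ltW.
Qed.

Lemma bigO_near r p q (f g : R -> 'M[Cx R]_(p, q)) :
  (\forall e \near 0^'+, f e = g e) -> bigO_eps r g -> bigO_eps r f.
Proof.
by move=> fg [c c0 gc]; exists c => //; apply: filterS2 fg gc => e ->.
Qed.

Lemma bigO_weaken r s p q (f : R -> 'M[Cx R]_(p, q)) :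
  (s <= r)%N -> bigO_eps r f -> bigO_eps s f.
Proof.
move=> sr [c c0 fc]; exists c => //; apply: filterS2 fc near0_itv => e + /andP[e0 e1].
by move/le_trans; apply; rewrite toC_le ler_wpM2l// ler_wiXn2l// ltW.
Qed.

Lemma bigOD r p q (f g : R -> 'M[Cx R]_(p, q)) :
  bigO_eps r f -> bigO_eps r g -> bigO_eps r (fun e => f e + g e).
Proof.
move=> [c c0 fc] [d d0 gd]; exists (c + d); first exact: addr_ge0.
apply: filterS2 fc gd => e fe ge; rewrite (le_trans (ler_normD _ _))//.
by rewrite mulrDl rmorphD lerD.
Qed.

Lemma bigON r p q (f : R -> 'M[Cx R]_(p, q)) :
  bigO_eps r f -> bigO_eps r (fun e => - f e).
Proof.
by move=> [c c0 fc]; exists c => //; apply: filterS fc => e; rewrite normrN.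
Qed.

Lemma bigOB r p q (f g : R -> 'M[Cx R]_(p, q)) :
  bigO_eps r f -> bigO_eps r g -> bigO_eps r (fun e => f e - g e).
Proof. by move=> fr /bigON; apply: bigOD. Qed.

Lemma bigOZ r p q (a : Cx R) (f : R -> 'M[Cx R]_(p, q)) :
  bigO_eps r f -> bigO_eps r (fun e => a *: f e).
Proof.
move=> [c c0 fc]; have [x x0 ax] := ge0_toC (normr_ge0 a).
exists (x * c); first exact: mulr_ge0.
by apply: filterS fc => e fe; rewrite mx_normZ -mulrA rmorphM ax ler_wpM2l ?toC_ge0.
Qed.

Lemma bigOM r s p q t (f : R -> 'M[Cx R]_(p, q)) (g : R -> 'M[Cx R]_(q, t)) :
  bigO_eps r f -> bigO_eps s g -> bigO_eps (r + s) (fun e => f e *m g e).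
Proof.
move=> [c c0 fc] [d d0 gd]; exists (q%:R * (c * d)); first by rewrite !mulr_ge0.
apply: filterS2 fc gd => e fe ge; rewrite (le_trans (mx_norm_mul _ _))//.
have -> : toC (q%:R * (c * d) * e ^+ (r + s))
    = q%:R * (toC (c * e ^+ r) * toC (d * e ^+ s)).
  by rewrite exprD -mulrA mulrACA rmorphM rmorph_nat rmorphM.
by rewrite ler_wpM2l// ler_pM.
Qed.

Lemma bigO_adj r p q (f : R -> 'M[Cx R]_(p, q)) :
  bigO_eps r f -> bigO_eps r (fun e => (f e) ^t*).
Proof.
by move=> [c c0 fc]; exists c => //; apply: filterS fc => e; rewrite mx_norm_adj.
Qed.

Lemma bigO_monomial r p q (A : 'M[Cx R]_(p, q)) :
  bigO_eps r (fun e => toC e ^+ r *: A).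
Proof.
have [x x0 Ax] := mx_norm_toC A; exists x => //.
apply: filterS near0_itv => e /andP[e0 _].
by rewrite mx_normZ -rmorphXn toC_norm ger0_norm ?exprn_ge0 ?(ltW e0)// Ax -rmorphM mulrC.
Qed.

Lemma bigO_cst p q (A : 'M[Cx R]_(p, q)) : bigO_eps 0 (fun=> A).
Proof.
by have := bigO_monomial 0 A; apply: bigO_near; near=> e; rewrite expr0 scale1r.
Unshelve. all: by end_near. Qed.

Definition taylor2 p q (F0 F1 F2 : 'M[Cx R]_(p, q)) (e : R) : 'M[Cx R]_(p, q) :=
  F0 + toC e *: F1 + toC e ^+ 2 *: F2.

Definition expands p q (f : R -> 'M[Cx R]_(p, q)) (F0 F1 F2 : 'M[Cx R]_(p, q)) :=
  bigO_eps 3 (fun e => f e - taylor2 F0 F1 F2 e).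

Lemma expands_taylor2 p q (F0 F1 F2 : 'M[Cx R]_(p, q)) :
  expands (taylor2 F0 F1 F2) F0 F1 F2.
Proof.
exists 0 => //; apply: nearW => e.
by rewrite subrr normr0 mul0r rmorph0.
Qed.

Lemma expands_near p q (f g : R -> 'M[Cx R]_(p, q)) F0 F1 F2 :
  (\forall e \near 0^'+, f e = g e) -> expands g F0 F1 F2 -> expands f F0 F1 F2.
Proof. by move=> fg; apply: bigO_near; apply: filterS fg => e ->. Qed.

Lemma expands_eq_2nd_order p q (f g : R -> 'M[Cx R]_(p, q)) F0 F1 F2 :
  expands f F0 F1 F2 -> expands g F0 F1 F2 -> eq_2nd_order f g.
Proof.
move=> hf hg; apply/eq_2nd_orderP; apply: bigO_near (bigOB hf hg).
by apply: nearW => e; rewrite opprB addrA subrK.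
Qed.

Lemma expandsO3 p q (f g : R -> 'M[Cx R]_(p, q)) F0 F1 F2 :
  expands f F0 F1 F2 -> expands g F0 F1 F2 -> bigO_eps 3 (fun e => f e - g e).
Proof.
move=> hf hg; apply: bigO_near (bigOB hf hg).
by apply: nearW => e; rewrite opprB addrA subrK.
Qed.

Lemma taylor2_O0 p q (F0 F1 F2 : 'M[Cx R]_(p, q)) : bigO_eps 0 (taylor2 F0 F1 F2).
Proof.
apply: bigOD; last exact: bigO_weaken (bigO_monomial 2 F2).
by apply: bigOD (bigO_cst _) _; exact: bigO_weaken (bigO_monomial 1 F1).
Qed.

Lemma expandsO0 p q (f : R -> 'M[Cx R]_(p, q)) F0 F1 F2 :
  expands f F0 F1 F2 -> bigO_eps 0 f.
Proof.
move=> /(bigO_weaken (leq0n 3)) hf.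
apply: bigO_near (bigOD hf (taylor2_O0 F0 F1 F2)).
by apply: nearW => e; rewrite subrK.
Qed.

Lemma expandsO1 p q (f : R -> 'M[Cx R]_(p, q)) F0 F1 F2 :
  expands f F0 F1 F2 -> bigO_eps 1 (fun e => f e - F0).
Proof.
move=> /(@bigO_weaken 3 1) -/(_ isT) hf.
have h2 := @bigO_weaken 2 1 _ _ _ isT (bigO_monomial 2 F2).
apply: bigO_near (bigOD hf (bigOD (bigO_monomial 1 F1) h2)).
apply: nearW => e; rewrite /taylor2 -[F0 + _ + _]addrA opprD !addrA.
by rewrite -addrA subrK.
Qed.

Lemma expandsD p q (f g : R -> 'M[Cx R]_(p, q)) F0 F1 F2 G0 G1 G2 :
  expands f F0 F1 F2 -> expands g G0 G1 G2 ->
  expands (fun e => f e + g e) (F0 + G0) (F1 + G1) (F2 + G2).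
Proof.
move=> hf hg; apply: bigO_near (bigOD hf hg).
by apply: nearW => e; apply/matrixP => i j; rewrite !mxE; ring.
Qed.

Lemma expandsZ p q a (f : R -> 'M[Cx R]_(p, q)) F0 F1 F2 :
  expands f F0 F1 F2 -> expands (fun e => a *: f e) (a *: F0) (a *: F1) (a *: F2).
Proof.
move=> /(bigOZ a); apply: bigO_near; apply: nearW => e.
by rewrite scalerBr /taylor2 !scalerDr !scalerA ![a * _]mulrC.
Qed.

Lemma expands_sum p q (I : Type) (s : seq I) (f : I -> R -> 'M[Cx R]_(p, q))
    (F0 F1 F2 : I -> 'M[Cx R]_(p, q)) :
  (forall i, expands (f i) (F0 i) (F1 i) (F2 i)) ->
  expands (fun e => \sum_(i <- s) f i e)
    (\sum_(i <- s) F0 i) (\sum_(i <- s) F1 i) (\sum_(i <- s) F2 i).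
Proof.
move=> h; elim: s => [|i s IH].
  rewrite !big_nil; have := expands_taylor2 (0 : 'M[Cx R]_(p, q)) 0 0.
  by apply: expands_near; apply: nearW => e; rewrite big_nil /taylor2 !scaler0 !addr0.
rewrite !big_cons; apply: expands_near (expandsD (h i) IH).
by apply: nearW => e; rewrite big_cons.
Qed.

Lemma adjmx_taylor2 p q (F0 F1 F2 : 'M[Cx R]_(p, q)) e :
  (taylor2 F0 F1 F2 e) ^t* = taylor2 (F0 ^t*) (F1 ^t*) (F2 ^t*) e.
Proof.
rewrite /taylor2 (adjmxD (F0 + _)) (adjmxD F0) (adjmxZ _ F1) (adjmxZ _ F2).
by rewrite rmorphXn /= !conj_toC.
Qed.

Lemma expands_adj p q (f : R -> 'M[Cx R]_(p, q)) F0 F1 F2 :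
  expands f F0 F1 F2 -> expands (fun e => (f e) ^t*) (F0 ^t*) (F1 ^t*) (F2 ^t*).
Proof.
move=> /bigO_adj; apply: bigO_near; apply: nearW => e.
by rewrite adjmxD adjmxN adjmx_taylor2.
Qed.

(** With [S] and [T] the two Taylor polynomials, [f g - S T = (f - S) g + S (g - T)] is of third
    order because [g] and [S] are bounded. The product [S T] adds terms of degree 3 and 4. *)
Lemma expandsM p q t (f : R -> 'M[Cx R]_(p, q)) (g : R -> 'M[Cx R]_(q, t))
    F0 F1 F2 G0 G1 G2 :
  expands f F0 F1 F2 -> expands g G0 G1 G2 ->
  expands (fun e => f e *m g e) (F0 *m G0) (F0 *m G1 + F1 *m G0)
    (F0 *m G2 + F1 *m G1 + F2 *m G0).
Proof.
move=> hf hg.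
have h1 : bigO_eps 3 (fun e => (f e - taylor2 F0 F1 F2 e) *m g e).
  exact: bigOM hf (expandsO0 hg).
have h2 : bigO_eps 3 (fun e => taylor2 F0 F1 F2 e *m (g e - taylor2 G0 G1 G2 e)).
  exact: (bigOM (taylor2_O0 _ _ _) hg).
have h3 := bigO_monomial 3 (F1 *m G2 + F2 *m G1).
have h4 := @bigO_weaken 4 3 _ _ _ isT (bigO_monomial 4 (F2 *m G2)).
apply: bigO_near (bigOD (bigOD h1 h2) (bigOD h3 h4)); apply: nearW => e.
rewrite mulmxBl mulmxBr [X in _ = X + _]addrA subrK.
by rewrite /taylor2 mulmx_quadratic [in RHS]opprD [X in _ = X + _]addrA subrK.
Qed.

End Expansions.

(** * From the expansion of a matrix to those of its polar factors *)

Section PolarExpansion.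
Variables (R : realType) (d : nat).
Implicit Types (M T X : R -> 'M[Cx R]_d).

(** As [T - a = O(eps)], the term of [psdmx_sqrt_stability] quadratic in [D] is eventually at most
    half of [a |D|^2] and is absorbed on the left. Cancelling one factor [|D|] leaves [|D|] bounded
    by a multiple of [|M^2 - T^2|]. *)
Lemma bigO_psdmx_sqrt M T (a : R) : 0 < a ->
  (\forall e \near 0^'+, psdmx (M e)) -> (forall e, (T e) ^t* = T e) ->
  bigO_eps 1 (fun e => T e - (toC a)%:M) ->
  bigO_eps 3 (fun e => M e *m M e - T e *m T e) ->
  bigO_eps 3 (fun e => M e - T e).
Proof.
move=> a0 pM hT [b b0 hb] [c c0 hc].
have small : \forall e \near (0 : R)^'+, d%:R ^+ 3 * (b * e) <= a / 2.
  (* The added 1 keeps the divisor positive when [b] or [d] is 0. *)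
  have K0 : 0 < d%:R ^+ 3 * b + 1 by rewrite ltr_wpDl// mulr_ge0// exprn_ge0.
  have h := nbhs_right_lt (divr_gt0 (divr_gt0 a0 (ltr0Sn R 1)) K0).
  apply: filterS2 h (near0_itv R) => e + /andP[e0 _].
  rewrite ltr_pdivlMr// => /ltW; apply: le_trans.
  by rewrite mulrDr mulr1 mulrA mulrC lerDl ltW.
exists (2 / a * d%:R ^+ 2 * c); first by rewrite !mulr_ge0// ?exprn_ge0// invr_ge0 ltW.
near=> e.
have := @psdmx_sqrt_stability _ d (toC a) (M e) (T e).
rewrite toC_ge0 (ltW a0) => /(_ isT) stab.
have /stab/(_ (hT e)) : psdmx (M e) by near: e.
have hbe : `|T e - (toC a)%:M| <= toC (b * e ^+ 1) by near: e.
have hce : `|M e *m M e - T e *m T e| <= toC (c * e ^+ 3) by near: e.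
have sme : d%:R ^+ 3 * (b * e) <= a / 2 by near: e.
have [x x0 ex] := mx_norm_toC (M e - T e).
have [y y0 ey] := mx_norm_toC (M e *m M e - T e *m T e).
have [z z0 ez] := mx_norm_toC (T e - (toC a)%:M).
move: hbe hce; rewrite ex ey ez !toC_le => hz hy {}stab.
rewrite -!(rmorph_nat (@toC R)) -!rmorphXn -!rmorphM -rmorphD toC_le in stab.
(* The factor [x = |M - T|] is cancelled below, so the value 0 is settled separately. *)
have [->|xn0] := eqVneq x 0.
  by rewrite !mulr_ge0// ?exprn_ge0 ?invr_ge0 ?(ltW a0)//; near: e; exact: nbhs_right_ge.
have xgt0 : 0 < x by rewrite lt0r xn0.
have hx : a / 2 * x <= d%:R ^+ 2 * y.
  rewrite -(ler_pM2r xgt0).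
  have : d%:R ^+ 3 * (x ^+ 2 * z) <= a / 2 * x ^+ 2.
    rewrite mulrCA mulrC ler_wpM2r ?exprn_ge0//; apply: le_trans sme.
    by rewrite ler_wpM2l ?exprn_ge0// -[e in leRHS]expr1.
  by lra.
have -> : x = 2 / a * (a / 2 * x) by field; rewrite gt_eqF.
have -> : 2 / a * d%:R ^+ 2 * c * e ^+ 3 = 2 / a * (d%:R ^+ 2 * (c * e ^+ 3)) by ring.
rewrite (ler_wpM2l (divr_ge0 _ (ltW a0)))//.
by rewrite (le_trans hx)// ler_wpM2l ?exprn_ge0.
Unshelve. all: by end_near. Qed.

(* [X = a^-1 (X T - X (T - a))], so each round improves [X = O(eps^r)] to
   [X = O(eps^(r+1))] for [r < 3]. *)
Lemma bigO_mulr_cancel X T (a : Cx R) : a != 0 ->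
  bigO_eps 0 X -> bigO_eps 1 (fun e => T e - a%:M) ->
  bigO_eps 3 (fun e => X e *m T e) -> bigO_eps 3 X.
Proof.
move=> a0 X0 T1 XT.
have step r : (r < 3)%N -> bigO_eps r X -> bigO_eps r.+1 X.
  move=> r3 Xr.
  have h2 : bigO_eps r.+1 (fun e => X e *m (T e - a%:M)).
    by rewrite -addn1; exact: bigOM.
  apply: bigO_near (bigOZ a^-1 (bigOB (bigO_weaken r3 XT) h2)).
  apply: nearW => e; rewrite mulmxBr opprB addrC subrK mul_mx_scalar.
  by rewrite scalerA mulVf// scale1r.
exact: (step 2 isT (step 1 isT (step 0 isT X0))).
Qed.

(** Rows of a unitary matrix have length 1, so every entry has modulus at most 1. *)
Lemma bigO_unitarymx U :
  (\forall e \near (0 : R)^'+, (U e : 'M[Cx R]_d) \is unitarymx) -> bigO_eps 0 U.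
Proof.
move=> uU; exists 1 => //; apply: filterS uU => e uU.
rewrite mulr1 rmorph1; apply: mx_norm_ler => // i j.
have := unitarymxP uU => /matrixP/(_ i i); rewrite !mxE eqxx /= => e1.
rewrite -(@expr_le1 _ 2)// -[leRHS]e1 (bigD1 j)//= adjmxE -normCK lerDl.
by rewrite sumr_ge0// => k _; rewrite adjmxE mul_conjC_ge0.
Qed.

(** The equations compare coefficients. Those for [K1 + K1 ^t*] and [K2 + K2 ^t*] are orders 1 and 2
    of [M^2 = K^* K], the former divided by [a]; the last two are orders 1 and 2 of [U M = K]. *)
Lemma expands_polar (K U M : R -> 'M[Cx R]_d) (a : R) (K1 K2 M1 M2 U1 U2 : 'M[Cx R]_d) :
  0 < a -> M1 ^t* = M1 -> M2 ^t* = M2 ->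
  (\forall e \near 0^'+, polar_decomposition (K e) (U e) (M e)) ->
  expands K (toC a)%:M K1 K2 ->
  K1 + K1 ^t* = M1 + M1 ->
  toC a *: (K2 + K2 ^t*) + K1 ^t* *m K1 = toC a *: (M2 + M2) + M1 *m M1 ->
  M1 + toC a *: U1 = K1 -> M2 + U1 *m M1 + toC a *: U2 = K2 ->
  expands M (toC a)%:M M1 M2 /\ expands U 1%:M U1 U2.
Proof.
move=> a0 hM1 hM2 pol hK e1 e2 f1 f2.
have hA : ((toC a)%:M : 'M[Cx R]_d) ^t* = (toC a)%:M.
  by rewrite tr_scalar_mx map_scalar_mx /= conj_toC.
have eM : expands M (toC a)%:M M1 M2.
  apply: bigO_psdmx_sqrt a0 _ _ _ _.
  - by apply: filterS pol => e [].
  - by move=> e; rewrite adjmx_taylor2 hA hM1 hM2.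
  - exact: (expandsO1 (expands_taylor2 _ _ _)).
  have hT := expandsM (expands_taylor2 (toC a)%:M M1 M2) (expands_taylor2 (toC a)%:M M1 M2).
  have := expandsM (expands_adj hK) hK; rewrite hA !mul_scalar_mx !mul_mx_scalar.
  have E1 : toC a *: K1 + toC a *: K1 ^t* = toC a *: M1 + toC a *: M1.
    by rewrite -!scalerDr e1.
  have E2 : toC a *: K2 + K1 ^t* *m K1 + toC a *: K2 ^t*
      = toC a *: M2 + M1 *m M1 + toC a *: M2.
    by rewrite addrAC -scalerDr e2 scalerDr addrAC.
  rewrite E1 E2 => hKK.
  rewrite !mul_scalar_mx !mul_mx_scalar in hT.
  apply: expandsO3 (expands_near _ hKK) hT.
  by apply: filterS pol => e /polar_sqr.
split=> //.
apply: (@bigO_mulr_cancel _ M (toC a)).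
- by rewrite fmorph_eq0 gt_eqF.
- apply: bigOB; last exact: taylor2_O0.
  by apply: bigO_unitarymx; apply: filterS pol => e [].
- exact: (expandsO1 eM).
have := expandsM (expands_taylor2 1%:M U1 U2) eM.
rewrite !mul1mx !mul_mx_scalar f1 f2 => hVM.
apply: bigO_near (expandsO3 hK hVM).
by apply: filterS pol => e [_ _ ->]; rewrite mulmxBl.
Qed.

End PolarExpansion.

(** * Expansion of the exponential *)

Section ComplexSeries.
Variable R : realType.
Implicit Types z : Cx R.

Lemma normc_Re z : toC `|complex.Re z| <= `|z|.
Proof. exact: normc_ge_Re. Qed.

Lemma normc_Im z : toC `|complex.Im z| <= `|z|.
Proof.
have := normc_Re (z * 'i%C); rewrite ReiNIm normrN normrM.
suff -> : `|'i%C : Cx R| = 1 by rewrite mulr1.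
by rewrite normc_def /= expr0n /= add0r expr1n sqrtr1.
Qed.

Lemma normc_le_ReIm z : `|z| <= toC (`|complex.Re z| + `|complex.Im z|).
Proof.
case: z => a b; rewrite [X in `|X|]complexE /= (le_trans (ler_normD _ _))//.
rewrite rmorphD lerD ?toC_norm// normrM.
suff -> : `|'i%C : Cx R| = 1 by rewrite mul1r toC_norm.
by rewrite normc_def /= expr0n /= add0r expr1n sqrtr1.
Qed.

Lemma is_cvg_series_dominated (u v : R^nat) :
  (forall m, `|u m| <= v m) -> cvgn (series v) -> cvgn (series u).
Proof.
move=> uv; move/(series_le_cvg _ _ uv) => h; apply: normed_cvg; apply: h => // m.
exact: le_trans (uv m).
Qed.

Lemma Re_series (u : nat -> Cx R) n :
  complex.Re (series u n) = series (fun m => complex.Re (u m)) n.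
Proof.
rewrite /series /=; elim: n => [|n IH]; first by rewrite !big_nil.
by rewrite !big_nat_recr //= -IH; case: (\sum_(_ <= _ < _) _) => a b; case: (u n).
Qed.

Lemma Im_series (u : nat -> Cx R) n :
  complex.Im (series u n) = series (fun m => complex.Im (u m)) n.
Proof.
rewrite /series /=; elim: n => [|n IH]; first by rewrite !big_nil.
by rewrite !big_nat_recr //= -IH; case: (\sum_(_ <= _ < _) _) => a b; case: (u n).
Qed.

(** Completeness of the reals is applied to the real and imaginary parts. The conclusion has the
    form in which limits of matrix entries are combined in [cvg_mexp]. *)
Lemma cvg_complex_series_dominated (u : nat -> Cx R) (v : R^nat) :
  (forall m, `|u m| <= toC (v m)) -> cvgn (series v) ->
  exists l : Cx R, forall e : Cx R, 0 < e -> \forall n \near \oo, `|l - series u n| <= e.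
Proof.
move=> uv cv.
have cRe : cvgn (series (fun m => complex.Re (u m))).
  apply: is_cvg_series_dominated cv => m.
  by rewrite -toC_le (le_trans (normc_Re _)).
have cIm : cvgn (series (fun m => complex.Im (u m))).
  apply: is_cvg_series_dominated cv => m.
  by rewrite -toC_le (le_trans (normc_Im _)).
pose l : R[i] := (limn (series (fun m => complex.Re (u m)))
  +i* limn (series (fun m => complex.Im (u m))))%C.
exists l => e e0; have [r r0 er] := ge0_toC (ltW e0).
have {e0}r0 : 0 < r / 2 by rewrite divr_gt0// -ltcR -[X in _ < X]er.
have /cvgrPdist_le/(_ _ r0) h1 := cRe.
have /cvgrPdist_le/(_ _ r0) h2 := cIm.
apply: filterS2 h1 h2 => n h1 h2.
rewrite (le_trans (normc_le_ReIm _))// er toC_le.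
have -> : complex.Re (l - series u n)
    = limn (series (fun m => complex.Re (u m))) - series (fun m => complex.Re (u m)) n.
  by rewrite -Re_series /l; case: (series u n).
have -> : complex.Im (l - series u n)
    = limn (series (fun m => complex.Im (u m))) - series (fun m => complex.Im (u m)) n.
  by rewrite -Im_series /l; case: (series u n).
by rewrite (le_trans (lerD h1 h2))// -splitr.
Qed.

End ComplexSeries.

Section MatrixExponential.
Variables (R : realType) (d : nat).
Implicit Types A H : 'M[Cx R]_d.

(** Bounding [d |A|] by [x] absorbs the dimension factor of [mx_norm_mul], so the real exponential
    series at [x] dominates the matrix series term by term. *)
Lemma mx_norm_exp A (x : R) m : d%:R * `|A| <= toC x -> `|A ^+ m| <= toC (x ^+ m).
Proof.
move=> Ax; elim: m => [|m IH].
  rewrite !expr0 rmorph1; apply: mx_norm_ler => // i j.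
  by rewrite mxE; case: eqP => _; rewrite ?normr1// normr0 ler01.
by rewrite exprS (le_trans (mx_norm_mul _ _))// mulrA exprS rmorphM ler_pM.
Qed.

Definition exp_term A (m : nat) : 'M[Cx R]_d := (m`!%:R)^-1 *: A ^+ m.

Lemma mx_norm_exp_term A (x : R) m : d%:R * `|A| <= toC x ->
  `|exp_term A m| <= toC (exp_coeff x m).
Proof.
move=> Ax; rewrite mx_normZ normfV normr_nat /exp_coeff /= mulrC.
rewrite rmorphM fmorphV rmorph_nat ler_wpM2r ?invr_ge0//.
exact: mx_norm_exp.
Qed.

(** [mexp] is a [limn], so it can be estimated only once convergence is established. The limit is
    assembled entry by entry; having finitely many entries makes the convergence uniform. *)
Lemma cvg_mexp A : series (exp_term A) n @[n --> \oo] --> mexp A.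
Proof.
have [x _ Ax] : exists2 x : R, 0 <= x & d%:R * `|A| = toC x.
  by apply: ge0_toC; rewrite mulr_ge0.
have entry i j : exists l : Cx R, forall e : Cx R, 0 < e ->
    \forall n \near \oo, `|l - series (fun m => exp_term A m i j) n| <= e.
  apply: (@cvg_complex_series_dominated _ _ (exp_coeff x)).
    by move=> m; rewrite (le_trans (ler_mx_norm_entry _ _ _))// mx_norm_exp_term// Ax.
  exact: is_cvg_series_exp_coeff.
have [L hL] : exists L : 'M[Cx R]_d, forall i j (e : Cx R), 0 < e ->
    \forall n \near \oo, `|L i j - series (fun m => exp_term A m i j) n| <= e.
  exists (\matrix_(i, j) projT1 (cid (entry i j))) => i j.
  by rewrite mxE; case: cid.
have cL : series (exp_term A) n @[n --> \oo] --> L.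
  apply/cvgrPdist_le => e e0.
  have : \forall n \near \oo, forall ij : 'I_d * 'I_d,
      `|L ij.1 ij.2 - series (fun m => exp_term A m ij.1 ij.2) n| <= e.
    by apply: filter_forall => ij; exact: hL.
  apply: filterS => n h; apply: mx_norm_ler (ltW e0) _ => i j.
  by have := h (i, j); rewrite !mxE /series /= summxE.
suff -> : mexp A = L by [].
exact/cvg_lim/cL.
Qed.

Lemma series_exp_coeff_le (x : R) n : 0 <= x -> series (exp_coeff x) n <= expR x.
Proof.
move=> x0; apply: nondecreasing_cvgn_le (is_cvg_series_exp_coeff x) n.
by apply: nondecreasing_series => m _ _; rewrite /exp_coeff /= divr_ge0 ?exprn_ge0.
Qed.

(** Since [(m + 3)! >= m!], the tail from degree 3 is at most [x^3] times the exponential series of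
    [x]. *)
Lemma mexp_taylor2 A (x : R) : 0 <= x -> d%:R * `|A| <= toC x ->
  `|mexp A - (1%:M + A + 2^-1 *: (A *m A))| <= toC (x ^+ 3 * expR x).
Proof.
move=> x0 Ax; apply/ler_addgt0Pr => e e0.
have /cvgrPdist_le/(_ _ e0)[N _ hN] := @cvg_mexp A.
(* Cutting at [N + 3] leaves exactly [N] terms once degrees 0, 1 and 2 are removed. *)
have {hN} := hN (N + 3)%N (leq_addr _ _) => /= h.
have tail : `|series (exp_term A) (N + 3)%N - (1%:M + A + 2^-1 *: (A *m A))|
    <= toC (x ^+ 3 * expR x).
  have -> : 1%:M + A + 2^-1 *: (A *m A) = series (exp_term A) 3.
    rewrite /series /= !big_nat_recr //= big_nil add0r /exp_term.
    by rewrite invr1 !scale1r expr0 expr1 expr2.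
  have := big_addn 0 (N + 3) 3 xpredT (exp_term A); rewrite add0n addnK => shift.
  rewrite sub_series_geq ?leq_addl// shift.
  rewrite (le_trans (ler_norm_sum _ _ _))//.
  apply: (@le_trans _ _ (toC (x ^+ 3 * series (exp_coeff x) N))).
    rewrite /series /= mulr_sumr rmorph_sum ler_sum// => m _.
    rewrite (le_trans (mx_norm_exp_term _ Ax))// toC_le /exp_coeff /=.
    rewrite exprD -mulrA mulrCA !ler_wpM2l ?exprn_ge0//.
    rewrite lef_pV2 ?posrE ?ltr0n ?fact_gt0//.
    by rewrite ler_nat leq_fact// leq_addr.
  by rewrite toC_le ler_wpM2l ?exprn_ge0// series_exp_coeff_le.
have -> : mexp A - (1%:M + A + 2^-1 *: (A *m A)) =
    (series (exp_term A) (N + 3)%N - (1%:M + A + 2^-1 *: (A *m A)))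
    + (mexp A - series (exp_term A) (N + 3)%N) by rewrite [RHS]addrC addrA subrK.
by rewrite (le_trans (ler_normD _ _))// lerD.
Qed.

Lemma expands_expi H :
  expands (fun e => expi e H) 1%:M (imC R *: H) (- (2^-1 *: (H *m H))).
Proof.
have [h h0 eh] : exists2 h : R, 0 <= h & d%:R * `|H| = toC h.
  by apply: ge0_toC; rewrite mulr_ge0.
(* The bound is [(h e)^3 exp (h e)], and [e < 1] gives [exp (h e) <= exp h]. *)
exists (h ^+ 3 * expR h); first by rewrite mulr_ge0 ?exprn_ge0 ?expR_ge0.
apply: filterS (near0_itv R) => e /andP[e0 e1].
have normi : `|imC R| = 1 by rewrite /imC normCi.
have bound : d%:R * `|(imC R * toC e) *: H| <= toC (h * e).
  rewrite mx_normZ normrM normi mul1r toC_norm gtr0_norm//.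
  by rewrite mulrCA eh -rmorphM mulrC.
have he0 : 0 <= h * e by rewrite mulr_ge0// ltW.
have := mexp_taylor2 he0 bound; rewrite -/(expi e H).
have -> : taylor2 1%:M (imC R *: H) (- (2^-1 *: (H *m H))) e
    = 1%:M + (imC R * toC e) *: H
      + 2^-1 *: (((imC R * toC e) *: H) *m ((imC R * toC e) *: H)).
  rewrite /taylor2 scalerA [toC e * _]mulrC -scalemxAl -scalemxAr !scalerA.
  congr (_ + _); rewrite scalerN -scaleNr scalerA; congr (_ *: _).
  have i2 : imC R * imC R = -1 by rewrite -expr2 /imC sqrCi.
  by rewrite -mulrA [X in _ = _ * X]mulrACA i2; ring.
move=> hle; rewrite (le_trans hle)// toC_le exprMn mulrAC.
rewrite ler_wpM2r ?exprn_ge0 ?(ltW e0)// ler_wpM2l ?exprn_ge0// ler_expR.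
by rewrite ler_piMr// ltW.
Qed.

(** Expansions concern positive eps only, so the sign is moved from eps to [H]. *)
Lemma expands_expiN H :
  expands (fun e => expi (- e) H) 1%:M (- (imC R *: H)) (- (2^-1 *: (H *m H))).
Proof.
have := expands_expi (- H); rewrite mulmxN mulNmx opprK scalerN.
apply: expands_near; apply: nearW => e.
by rewrite /expi rmorphN mulrN scaleNr scalerN.
Qed.

End MatrixExponential.

(** * Tensor products and basis vectors *)

Section Tensor.
Variable C : numClosedFieldType.

Lemma tensmxDl m n p q (A B : 'M[C]_(m, n)) (X : 'M[C]_(p, q)) :
  (A + B) *t X = A *t X + B *t X.
Proof. by apply/matrixP => i j; rewrite !mxE mulrDl. Qed.

Lemma tensmxDr m n p q (X : 'M[C]_(m, n)) (A B : 'M[C]_(p, q)) :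
  X *t (A + B) = X *t A + X *t B.
Proof. by apply/matrixP => i j; rewrite !mxE mulrDr. Qed.

Lemma tensNmx m n p q (A : 'M[C]_(m, n)) (X : 'M[C]_(p, q)) :
  (- A) *t X = - (A *t X).
Proof. by apply/matrixP => i j; rewrite !mxE mulNr. Qed.

Lemma tensmxZl m n p q c (A : 'M[C]_(m, n)) (X : 'M[C]_(p, q)) :
  (c *: A) *t X = c *: (A *t X).
Proof. by apply/matrixP => i j; rewrite !mxE mulrA. Qed.

Lemma tensmxZr m n p q c (X : 'M[C]_(m, n)) (A : 'M[C]_(p, q)) :
  X *t (c *: A) = c *: (X *t A).
Proof. by apply/matrixP => i j; rewrite !mxE mulrCA. Qed.

Lemma tensmx_suml m n p q I (s : seq I) (P : pred I) (F : I -> 'M[C]_(m, n))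
    (X : 'M[C]_(p, q)) :
  (\sum_(i <- s | P i) F i) *t X = \sum_(i <- s | P i) F i *t X.
Proof.
by apply: (big_morph (fun A => A *t X)) => [A B|]; rewrite ?tensmxDl ?tens0mx.
Qed.

Lemma tensmx_sumr m n p q I (s : seq I) (P : pred I) (X : 'M[C]_(m, n))
    (F : I -> 'M[C]_(p, q)) :
  X *t (\sum_(i <- s | P i) F i) = \sum_(i <- s | P i) X *t F i.
Proof.
by apply: (big_morph (fun A => X *t A)) => [A B|]; rewrite ?tensmxDr ?tensmx0.
Qed.

Lemma adjmx_tens m n p q (A : 'M[C]_(m, n)) (B : 'M[C]_(p, q)) :
  (A *t B) ^t* = A ^t* *t B ^t*.
Proof. by rewrite trmx_tens map_mxT. Qed.

Lemma tensmx11 m n : (1%:M : 'M[C]_m) *t (1%:M : 'M[C]_n) = 1%:M.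
Proof.
apply/matrixP => i j; rewrite !mxE -natrM mulnb.
case: (mxtens_indexP i) => i1 i2; case: (mxtens_indexP j) => j1 j2.
by rewrite !mxtens_indexK /= (can_eq (@mxtens_indexK m n)).
Qed.

End Tensor.

Section OnSyndrome.
Variables (R : realType) (n k : nat).
Notation N := (dimN n k).
Notation os := (@on_syndrome R n k).
Implicit Types X Y : 'M[Cx R]_N.

Lemma on_syndrome_is_linear : linear os.
Proof. by move=> c X Y; rewrite /on_syndrome tensmxDr tensmxZr. Qed.

HB.instance Definition _ := GRing.isLinear.Build (Cx R) 'M[Cx R]_N 'M[Cx R]_(dimS n k)
  *:%R os on_syndrome_is_linear.

Lemma on_syndromeM X Y : os (X *m Y) = os X *m os Y.
Proof. by rewrite /on_syndrome tensmx_mul mul1mx. Qed.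

Lemma on_syndrome1 : os 1%:M = 1%:M.
Proof. exact: tensmx11. Qed.

Lemma on_syndrome_adj X : (os X) ^t* = os (X ^t*).
Proof. by rewrite /on_syndrome adjmx_tens adjmx1. Qed.

End OnSyndrome.

Section Kets.
Variables (R : realType) (d : nat).

Lemma bra_ket j l : (j < d)%N ->
  (ket R d j) ^t* *m ket R d l = (j == l)%:R%:M.
Proof.
move=> jd; apply/matrixP => u v; rewrite !ord1 !mxE mulr1n.
rewrite (bigD1 (Ordinal jd))//= !mxE big1 ?addr0 /= => [|i ij].
  by rewrite eqxx rmorph1 mul1r.
rewrite !mxE; have -> : (i == j :> nat) = false by apply/negbTE.
by rewrite rmorph0 mul0r.
Qed.

Lemma ketbra_ket i j l : (j < d)%N ->
  ketbra R d i j *m ket R d l = (j == l)%:R *: ket R d i.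
Proof. by move=> jd; rewrite /ketbra -mulmxA bra_ket// mul_mx_scalar. Qed.

Lemma ketbraM i j l m : (j < d)%N ->
  ketbra R d i j *m ketbra R d l m = (j == l)%:R *: ketbra R d i m.
Proof. by move=> jd; rewrite {2}/ketbra mulmxA ketbra_ket// -scalemxAl. Qed.

Lemma ketbra_adj i j : (ketbra R d i j) ^t* = ketbra R d j i.
Proof. by rewrite /ketbra adjmxM trmxCK. Qed.

Lemma sum_ketbra : \sum_(j < d) ketbra R d j j = 1%:M.
Proof.
apply/matrixP => u v; rewrite summxE (bigD1 u)//= big1 ?addr0 => [|i iu].
  by rewrite !mxE big_ord1 !mxE eqxx mul1r rmorph_nat eq_sym.
by rewrite !mxE big_ord1 !mxE eq_sym [_ == _ :> nat](negbTE iu) mul0r.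
Qed.

Lemma sum_ketE i j : (\sum_(l < d) ket R d l) i j = 1.
Proof.
rewrite summxE (bigD1 i)//= big1 ?addr0 => [|l li]; first by rewrite mxE eqxx.
by rewrite mxE eq_sym [_ == _ :> nat](negbTE li).
Qed.

End Kets.

Section Ancilla.
Variable R : realType.

Lemma ket_plusE i j : ket_plus R i j = (toC (Num.sqrt 2))^-1.
Proof.
by rewrite !mxE; case: i => [[|[|//]] ?] /=; rewrite ?addr0 ?add0r mulr1.
Qed.

Lemma ntensmx_ket_plus m i j :
  ntensmx (ket_plus R) m i j = (toC (Num.sqrt 2))^-1 ^+ m.
Proof.
elim: m i j => [|[|m] IH] i j.
- by rewrite ntensmx0 mxE expr0; rewrite (ord1 i) (ord1 j) eqxx.
- by rewrite ntensmx1 ket_plusE expr1.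
rewrite ntensmxSS; case: (mxtens_indexP i) => i1 i2; case: (mxtens_indexP j) => j1 j2.
by rewrite tensmxE IH [RHS]exprS ket_plusE.
Qed.

Lemma ket_plus_powE m :
  ket_plus_pow R m = (toC (Num.sqrt (2 ^ m)%:R))^-1 *: \sum_(l < 2 ^ m) ket R (2 ^ m) l.
Proof.
apply/matrixP => i j; rewrite castmxE ntensmx_ket_plus mxE sum_ketE mulr1.
rewrite exprVn -rmorphXn; congr (toC _)^-1; rewrite natrX.
by elim: m {i j} => [|m IH]; rewrite ?expr0 ?sqrtr1// !exprS sqrtrM// IH.
Qed.

Lemma dimA_eq n k : dimA n k = (2 * dimN n k)%N.
Proof. by rewrite /dimA addn1 expnS. Qed.

Lemma ancilla0E n k :
  ancilla0 R n k = (sqrt2N R n k)^-1 *: \sum_(l < 2 * dimN n k) ket R (dimA n k) l.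
Proof.
rewrite /ancilla0 ket_plus_powE /sqrt2N -dimA_eq; congr (_ *: _).
Qed.

End Ancilla.

(** * Expansion of the polar factors *)

Section AbstractPolar.
Variables (R : realType) (d : nat).
Implicit Types (Q : 'M[Cx R]_d) (K U M : R -> 'M[Cx R]_d) (z : Cx R).

(** The inverse is the geometric series, which stops after the linear term. *)
Lemma unitmx_scalar_nilpotent (C : numClosedFieldType) (c y : C) (Q : 'M[C]_d) :
  c != 0 -> Q *m Q = 0 -> c *: 1%:M + y *: Q \in unitmx.
Proof.
move=> c0 Q0.
have /mulmx1_unit[] // :
    (c *: 1%:M + y *: Q) *m (c^-1 *: 1%:M - (c^-1 ^+ 2 * y) *: Q) = 1%:M.
rewrite mulmxBr !mulmxDl -!scalemxAl -!scalemxAr Q0 !scaler0 addr0 !mulmx1 mul1mx !scalerA.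
rewrite divff// scale1r -addrA -scalerBl.
by rewrite (_ : _ - _ = 0) ?scale0r ?addr0//; field.
Qed.

(** The matrix acts as [c + y] on the range of [Q] and as [c] on its kernel. The inverse is
    [c^-1 (1 - Q) + (c + y)^-1 Q], rearranged. *)
Lemma unitmx_scalar_idempotent (C : numClosedFieldType) (c y : C) (Q : 'M[C]_d) :
  c != 0 -> c + y != 0 -> Q *m Q = Q -> c *: 1%:M + y *: Q \in unitmx.
Proof.
move=> c0 cy0 QQ.
have /mulmx1_unit[] // :
    (c *: 1%:M + y *: Q) *m (c^-1 *: 1%:M - (y / (c * (c + y))) *: Q) = 1%:M.
rewrite mulmxBr !mulmxDl -!scalemxAl -!scalemxAr QQ !mulmx1 mul1mx !scalerA.
rewrite divff// scale1r -addrA -scalerDl -scalerBl.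
by rewrite (_ : _ - _ = 0) ?scale0r ?addr0 //; field; rewrite cy0.
Qed.

(** Multiplying [1 - e^2/2 - t] by [1 - e^2/2 + t], which is at least 1/2, gives [e^4 / 4]. *)
Lemma sqrt1B_approx (e : R) : 0 < e < 1 ->
  `|Num.sqrt (1 - e ^+ 2) - (1 - e ^+ 2 / 2)| <= e ^+ 3.
Proof.
move=> /andP[e0 e1]; set t := Num.sqrt _.
have e2 : e ^+ 2 <= 1 by rewrite expr_le1 ?ltW.
have t0 : 0 <= t by exact: sqrtr_ge0.
have tt : t ^+ 2 = 1 - e ^+ 2 by rewrite sqr_sqrtr// subr_ge0.
have h : (1 - e ^+ 2 / 2 - t) * (1 - e ^+ 2 / 2 + t) = e ^+ 4 / 4.
  have -> : (1 - e ^+ 2 / 2 - t) * (1 - e ^+ 2 / 2 + t) = (1 - e ^+ 2 / 2) ^+ 2 - t ^+ 2.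
    by ring.
  by rewrite tt; field.
have e4 : e ^+ 4 <= e ^+ 3 by rewrite exprS ler_piMl ?exprn_ge0 ?ltW.
have e30 : 0 < e ^+ 3 by rewrite exprn_gt0.
have e40 : 0 < e ^+ 4 by rewrite exprn_gt0.
rewrite distrC ger0_norm; first by nra.
by nra.
Qed.

Lemma expands_sqrt1B p q (A : 'M[Cx R]_(p, q)) :
  expands (fun e => toC (Num.sqrt (1 - e ^+ 2)) *: A) A 0 (- (2^-1 *: A)).
Proof.
have [x x0 Ax] := mx_norm_toC A; exists x => //.
apply: filterS (near0_itv R) => e he.
have -> : toC (Num.sqrt (1 - e ^+ 2)) *: A - taylor2 A 0 (- (2^-1 *: A)) e
    = toC (Num.sqrt (1 - e ^+ 2) - (1 - e ^+ 2 / 2)) *: A.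
  rewrite /taylor2 scaler0 addr0 scalerN scalerA -[X in _ - (X - _)]scale1r -!scalerBl.
  by rewrite !rmorphB rmorphM fmorphV rmorphXn rmorph_nat rmorph1.
rewrite mx_normZ toC_norm Ax -rmorphM toC_le mulrC ler_wpM2l//.
exact: sqrt1B_approx.
Qed.

Lemma expands_polar_nilpotent K U M (a : R) z Q :
  0 < a -> z^* = - z -> Q *m Q = 0 ->
  (\forall e \near 0^'+, polar_decomposition (K e) (U e) (M e)) ->
  expands K (toC a)%:M ((toC a * z) *: Q) (- ((toC a / 2) *: 1%:M)) ->
  expands M (toC a)%:M ((toC a * z / 2) *: (Q - Q ^t*))
    (toC a *: (- (2^-1 *: 1%:M) + (z ^+ 2 / 8) *: (Q *m Q ^t*)
               - (3 * z ^+ 2 / 8) *: (Q ^t* *m Q)))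
  /\ expands U 1%:M ((z / 2) *: (Q + Q ^t*))
       ((z ^+ 2 / 8) *: (Q *m Q ^t* + Q ^t* *m Q)).
Proof.
move=> a0 hz QQ pol hK.
have QQ' : Q ^t* *m Q ^t* = 0 by rewrite -adjmxM QQ adjmx0.
have hP : (Q *m Q ^t*) ^t* = Q *m Q ^t* by rewrite adjmxM trmxCK.
have hP' : (Q ^t* *m Q) ^t* = Q ^t* *m Q by rewrite adjmxM trmxCK.
have cz : (z ^+ 2)^* = z ^+ 2 by rewrite rmorphXn /= hz sqrrN.
have c8 : (z ^+ 2 / 8)^* = z ^+ 2 / 8 by rewrite rmorphM /= cz fmorphV rmorph_nat.
have c38 : (3 * z ^+ 2 / 8)^* = 3 * z ^+ 2 / 8.
  by rewrite -[3 * _ / _]mulrA rmorphM /= c8 rmorph_nat.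
apply: (expands_polar a0 _ _ pol hK).
- rewrite adjmxZ adjmxD adjmxN trmxCK !rmorphM /= hz conj_toC fmorphV rmorph_nat.
  by rewrite mulrN mulNr scaleNr -scalerN opprB.
- rewrite adjmxZ conj_toC adjmxD adjmxN (adjmxD (- _)) adjmxN !adjmxZ adjmx1 hP hP'.
  by rewrite c8 c38 fmorphV rmorph_nat.
- rewrite adjmxZ rmorphM /= conj_toC hz.
  by apply/matrixP => i j; rewrite !mxE; field.
- rewrite adjmxN !adjmxZ adjmx1 !rmorphM /= conj_toC hz fmorphV rmorph_nat.
  rewrite -!scalemxAl -!scalemxAr mulmxBl !mulmxBr QQ QQ' sub0r subr0.
  move: (Q *m Q ^t*) (Q ^t* *m Q) => P P'.
  by apply/matrixP => i j; rewrite !mxE; field.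
- by apply/matrixP => i j; rewrite !mxE; field.
rewrite -!scalemxAl -!scalemxAr mulmxDl !mulmxBr QQ QQ' sub0r subr0.
move: (Q *m Q ^t*) (Q ^t* *m Q) => P P'.
by apply/matrixP => i j; rewrite !mxE; field.
Qed.

(** The first-order part of [K] is anti-Hermitian. It cancels in [K^* K], so [M] has no linear term
    and [U] takes all of it. *)
Lemma expands_polar_projector K U M (a : R) z Q :
  0 < a -> z^* = - z -> Q *m Q = Q -> Q ^t* = Q ->
  (\forall e \near 0^'+, polar_decomposition (K e) (U e) (M e)) ->
  expands K (toC a)%:M ((toC a * z) *: Q) (- ((toC a / 2) *: 1%:M)) ->
  expands M (toC a)%:M 0 (toC a *: (- (2^-1 *: 1%:M) - (z ^+ 2 / 2) *: Q))
  /\ expands U 1%:M (z *: Q) ((z ^+ 2 / 2) *: Q).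
Proof.
move=> a0 hz QQ hQ pol hK.
have cz : (z ^+ 2)^* = z ^+ 2 by rewrite rmorphXn /= hz sqrrN.
have c2 : (z ^+ 2 / 2)^* = z ^+ 2 / 2 by rewrite rmorphM /= cz fmorphV rmorph_nat.
apply: (expands_polar a0 _ _ pol hK).
- by rewrite adjmx0.
- rewrite adjmxZ conj_toC adjmxD !adjmxN !adjmxZ adjmx1 hQ.
  by rewrite c2 fmorphV rmorph_nat.
- rewrite adjmxZ rmorphM /= conj_toC hz hQ.
  by apply/matrixP => i j; rewrite !mxE; field.
- rewrite adjmxN !adjmxZ adjmx1 !rmorphM /= conj_toC hz fmorphV rmorph_nat hQ.
  rewrite -!scalemxAl -!scalemxAr QQ mul0mx.
  by apply/matrixP => i j; rewrite !mxE; field.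
- by rewrite add0r scalerA.
rewrite mulmx0.
by apply/matrixP => i j; rewrite !mxE; field.
Qed.

End AbstractPolar.

(** * Kraus operators *)

(** Terms linear in [y] cancel between the two signs. The minus sign on the right comes from
    [y^* = - y]. *)
Lemma kraus_pair (C : numClosedFieldType) d (a c y : C) (Q X : 'M[C]_d) :
  a^* = a -> c^* = c -> y^* = - y ->
  let K1 := a *: (c *: 1%:M + y *: Q) in let K2 := a *: (c *: 1%:M - y *: Q) in
  K1 *m X *m K1 ^t* + K2 *m X *m K2 ^t*
  = (2 * a ^+ 2 * (c * c)) *: X - (2 * a ^+ 2 * (y * y)) *: (Q *m X *m Q ^t*).
Proof.
move=> ha hc hy K1 K2.
have -> : K1 ^t* = a *: (c *: 1%:M - y *: Q ^t*).
  by rewrite adjmxZ ha adjmxD adjmxZ adjmxZ adjmx1 hc hy scaleNr.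
have -> : K2 ^t* = a *: (c *: 1%:M + y *: Q ^t*).
  by rewrite adjmxZ ha adjmxD adjmxN adjmxZ adjmxZ adjmx1 hc hy scaleNr opprK.
rewrite /K1 /K2 -?scalemxAl -?scalemxAr -?scalemxAl !mulmxDl !mulmxDr !mulNmx !mulmxN.
rewrite -?scalemxAl -?scalemxAr -?scalemxAl !mul1mx !mulmx1.
move: (Q *m X *m Q ^t*) (Q *m X) (X *m Q ^t*) => Y Y' Y''.
by apply/matrixP => u v; rewrite !mxE; ring.
Qed.

Section KrausOperators.
Variables (R : realType) (n k : nat).
Notation N := (dimN n k).
Notation os := (@on_syndrome R n k).
Notation sN := (sqrtN R n k).
Notation Q := (Rop R n k).

Lemma dimN_gt0 : (0 < N)%N.
Proof. by rewrite expn_gt0. Qed.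

(** Kept real because the polar expansions take a positive real leading coefficient. *)
Definition kraus_scale : R := (Num.sqrt (2 * N)%N%:R)^-1.
Notation al := kraus_scale.

Lemma kraus_scale_gt0 : 0 < al.
Proof. by rewrite invr_gt0 sqrtr_gt0 ltr0n muln_gt0 dimN_gt0. Qed.

Lemma toC_kraus_scale : toC al = (sqrt2N R n k)^-1.
Proof. exact: fmorphV. Qed.

Lemma kraus_scale_sqr : toC al ^+ 2 = (2 * N%:R)^-1.
Proof.
rewrite -rmorphXn exprVn sqr_sqrtr// fmorphV rmorph_nat.
by rewrite natrM.
Qed.

Lemma sqrtN_sqr : sN ^+ 2 = N%:R.
Proof. by rewrite -rmorphXn /= sqr_sqrtr// rmorph_nat. Qed.

Lemma sqrtN_neq0 : sN != 0.
Proof. by rewrite fmorph_eq0 gt_eqF// sqrtr_gt0 ltr0n dimN_gt0. Qed.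

Lemma conj_sqrtN : sN^* = sN.
Proof. exact: conj_toC. Qed.

Lemma imC_sqr : imC R ^+ 2 = -1.
Proof. exact: sqrCi. Qed.

Lemma conj_imC : (imC R)^* = - imC R.
Proof. exact: conjCi. Qed.

Lemma Rop_nilpotent j : (0 < j < N)%N -> Q j *m Q j = 0.
Proof.
case/andP=> j0 jN; rewrite -on_syndromeM ketbraM//.
by rewrite (gtn_eqF j0) scale0r linear0.
Qed.

Lemma Rop0_idempotent : Q 0%N *m Q 0%N = Q 0%N.
Proof. by rewrite -on_syndromeM ketbraM ?dimN_gt0// scale1r. Qed.

Lemma Rop_adj j : (Q j) ^t* = os (ketbra R N j 0).
Proof. by rewrite on_syndrome_adj ketbra_adj. Qed.

Lemma Kop_sgnE s (e : R) j : Kop_sgn n k s e j = toC al *: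
  (toC (Num.sqrt (1 - e ^+ 2)) *: 1%:M + (s * imC R * toC e * sN) *: Q j).
Proof. by rewrite /Kop_sgn toC_kraus_scale linearD !linearZ /= on_syndrome1. Qed.

Lemma Kop_lt (e : R) j : (j < N)%N -> Kop n k e j = Kop_sgn n k 1 e j.
Proof. by rewrite /Kop => ->. Qed.

Lemma Kop_ge (e : R) j : Kop n k e (N + j) = Kop_sgn n k (-1) e j.
Proof. by rewrite /Kop ltnNge leq_addr /= addKn. Qed.

Lemma big_ord_dimN2 (V : nmodType) (F : nat -> V) :
  \sum_(j < 2 * N) F j = \sum_(j < N) (F j + F (N + j)%N).
Proof. by rewrite mul2n -addnn big_split_ord /= -big_split. Qed.

Lemma dimN2_ind (P : nat -> Prop) :
  (forall j, (j < N)%N -> P j) -> (forall j, (j < N)%N -> P (N + j)%N) ->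
  forall j, (j < 2 * N)%N -> P j.
Proof.
move=> h1 h2 j jN; have [/h1//|Nj] := ltnP j N.
by rewrite -(subnKC Nj); apply: h2; rewrite ltn_subLR// addnn -mul2n.
Qed.

Lemma kraus_operators_Kop (e : R) : 0 < e < 1 ->
  kraus_operators (2 * N)%N (Kop n k e) (recovery_map e).
Proof.
move=> /andP[e0 e1] rho; rewrite (big_ord_dimN2 (fun j => Kop n k e j *m rho *m (Kop n k e j) ^t*)).
set c := toC (Num.sqrt (1 - e ^+ 2)).
have cc : c * c = toC (1 - e ^+ 2).
  by rewrite -expr2 -rmorphXn sqr_sqrtr// subr_ge0 expr_le1 ?ltW.
pose y : Cx R := imC R * toC e * sN.
have hy : y^* = - y.
  by rewrite !rmorphM /= conj_imC conj_toC conj_sqrtN !mulNr.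
have yy : y * y = - (toC (e ^+ 2) * N%:R).
  by rewrite -sqrtN_sqr -expr2 !exprMn imC_sqr rmorphXn !mulN1r mulNr.
have KE s j : Kop_sgn n k s e j = toC al *: (c *: 1%:M + (s * y) *: Q j).
  by rewrite Kop_sgnE /y !mulrA.
have pair (j : 'I_N) : Kop n k e j *m rho *m (Kop n k e j) ^t*
    + Kop n k e (N + j)%N *m rho *m (Kop n k e (N + j)%N) ^t*
    = (N%:R^-1 * toC (1 - e ^+ 2)) *: rho + toC (e ^+ 2) *: (Q j *m rho *m (Q j) ^t*).
  have K1 : Kop n k e j = toC al *: (c *: 1%:M + y *: Q j).
    by rewrite (Kop_lt _ (ltn_ord j)) KE (mul1r y).
  have K2 : Kop n k e (N + j) = toC al *: (c *: 1%:M - y *: Q j).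
    by rewrite Kop_ge KE (mulN1r y) (scaleNr y).
  rewrite K1 K2 (kraus_pair (Q j) rho (conj_toC al) (conj_toC _) hy).
  rewrite kraus_scale_sqr yy cc -(scaleNr _ (Q j *m rho *m _)).
  have N0 : N%:R != 0 :> Cx R by rewrite pnatr_eq0 -lt0n dimN_gt0.
  by congr (_ *: _ + _ *: _); field; rewrite N0.
rewrite (eq_bigr _ (fun j _ => pair j)) big_split /= sumr_const card_ord.
rewrite -scaler_sumr scalerMnl -mulrnAl -[N%:R^-1 *+ _]mulr_natl divff ?mul1r//.
by rewrite pnatr_eq0 -lt0n dimN_gt0.
Qed.

Lemma Kop_sgn_unitmx s (e : R) j : s^* = s -> 0 < e < 1 -> (j < N)%N ->
  Kop_sgn n k s e j \in unitmx.
Proof.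
move=> hs /andP[e0 e1] jN; rewrite Kop_sgnE.
rewrite unitmxZ ?unitfE ?fmorph_eq0 ?(gt_eqF kraus_scale_gt0)//.
have c0 : toC (Num.sqrt (1 - e ^+ 2)) != 0.
  by rewrite fmorph_eq0 gt_eqF// sqrtr_gt0 subr_gt0 expr_lt1 ?ltW.
have [j0|j0] := posnP j; last by apply: unitmx_scalar_nilpotent; rewrite ?Rop_nilpotent ?j0.
rewrite j0; apply: unitmx_scalar_idempotent Rop0_idempotent => //.
(* The first summand is real and the second purely imaginary, so adding the conjugate equation
   leaves twice the nonzero square root. *)
apply/eqP => cy0; have := congr1 Num.conj cy0.
rewrite rmorph0 rmorphD /= conj_toC !rmorphM /= hs conj_imC conj_toC conj_sqrtN.
move=> cy0'; have : toC (Num.sqrt (1 - e ^+ 2)) *+ 2 = 0.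
  by rewrite -[RHS](addr0 0) -{1}cy0 -{1}cy0'; ring.
by move/eqP; rewrite mulrn_eq0 /= (negbTE c0).
Qed.

Lemma Kop_unitmx (e : R) j : 0 < e < 1 -> (j < 2 * N)%N -> Kop n k e j \in unitmx.
Proof.
move=> he; apply: (@dimN2_ind (fun j => Kop n k e j \in unitmx)) => {}j jN.
  by rewrite Kop_lt// Kop_sgn_unitmx// rmorph1.
by rewrite Kop_ge Kop_sgn_unitmx// rmorphN rmorph1.
Qed.

Lemma expands_Kop_sgn s j :
  expands (fun e => Kop_sgn n k s e j : 'M[Cx R]_(dimS n k)) (toC al)%:M
    ((toC al * (s * imC R * sN)) *: Q j) (- ((toC al / 2) *: 1%:M)).
Proof.
have h1 := expands_sqrt1B (1%:M : 'M[Cx R]_(dimS n k)).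
have h2 := expands_taylor2 0 ((s * imC R * sN) *: Q j) 0.
have := expandsZ (toC al) (expandsD h1 h2).
rewrite addr0 add0r addr0 scalemx1 scalerN !scalerA; apply: expands_near.
apply: nearW => e; rewrite Kop_sgnE /taylor2 add0r scaler0 addr0 scalerA.
by rewrite [_ * toC e * _]mulrAC [toC e * _]mulrC.
Qed.

End KrausOperators.

(** * Row sums of the Hamiltonian *)

Section NilpotentPair.
Variables (C : numClosedFieldType) (d : nat) (Q Q' : 'M[C]_d).
Hypotheses (QQ : Q *m Q = 0) (QQ' : Q' *m Q' = 0).

Lemma mulmx_addB : (Q + Q') *m (Q - Q') = Q' *m Q - Q *m Q'.
Proof. by rewrite mulmxDl !mulmxBr QQ QQ' sub0r subr0 addrC. Qed.

Lemma mulmx_subB : (Q - Q') *m (Q - Q') = - (Q *m Q' + Q' *m Q).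
Proof. by rewrite mulmxBl !mulmxBr QQ QQ' sub0r subr0 opprD. Qed.

Lemma mulmx_addD : (Q + Q') *m (Q + Q') = Q *m Q' + Q' *m Q.
Proof. by rewrite mulmxDl !mulmxDr QQ QQ' add0r addr0. Qed.

End NilpotentPair.

Section KetbraProducts.
Variables (R : realType) (d j : nat).
Hypothesis jd : (0 < j < d)%N.
Notation kb := (ketbra R d).

Lemma ketbra_table :
  [/\ kb 0%N j *m kb 0%N j = 0, kb j 0%N *m kb j 0%N = 0,
      kb 0%N j *m kb j 0%N = kb 0%N 0%N & kb j 0%N *m kb 0%N j = kb j j].
Proof.
have [j0 lejd] := andP jd; have d0 := ltn_trans j0 lejd.
by rewrite !ketbraM ?eqxx ?(gtn_eqF j0) ?(ltn_eqF j0) ?scale0r ?scale1r.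
Qed.

Lemma ketbraAB : (kb 0%N j + kb j 0%N) *m (kb 0%N j - kb j 0%N) = kb j j - kb 0%N 0%N.
Proof. by have [h1 h2 <- <-] := ketbra_table; exact: mulmx_addB. Qed.

Lemma ketbraBB : (kb 0%N j - kb j 0%N) *m (kb 0%N j - kb j 0%N) = - (kb 0%N 0%N + kb j j).
Proof. by have [h1 h2 <- <-] := ketbra_table; exact: mulmx_subB. Qed.

Lemma ketbraAA : (kb 0%N j + kb j 0%N) *m (kb 0%N j + kb j 0%N) = kb 0%N 0%N + kb j j.
Proof. by have [h1 h2 <- <-] := ketbra_table; exact: mulmx_addD. Qed.

End KetbraProducts.

Section Hamiltonian.
Variables (R : realType) (n k : nat).
Notation N := (dimN n k).
Notation os := (@on_syndrome R n k).
Notation sN := (sqrtN R n k).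
Notation A := (Aop R n k).
Notation B := (Bop R n k).

Definition proj_syndrome (j : nat) : 'M[Cx R]_(dimS n k) := os (ketbra R N j j).
Notation P := proj_syndrome.

Lemma Aop_adj j : (A j) ^t* = A j.
Proof.
by rewrite /Aop on_syndrome_adj (adjmxD (ketbra _ _ 0 j)) !ketbra_adj addrC.
Qed.

Lemma Bop_adj j : (B j) ^t* = - B j.
Proof.
rewrite /Bop on_syndrome_adj (adjmxD (ketbra _ _ 0 j)) adjmxN !ketbra_adj.
by rewrite -[_ + _]opprB linearN.
Qed.

(** Lets the first-order coefficient [(sN / 2) *: B j] cover [j = 0] as well. *)
Lemma Bop0 : B 0%N = 0.
Proof. by rewrite /Bop subrr linear0. Qed.

Lemma Aop_Bop j : (0 < j < N)%N -> A j *m B j = P j - P 0%N.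
Proof.
move=> jN; rewrite /Aop /Bop -on_syndromeM (ketbraAB R jN).
by rewrite linearB.
Qed.

Lemma Bop_sqr j : (0 < j < N)%N -> B j *m B j = - (P 0%N + P j).
Proof.
move=> jN; rewrite /Bop -on_syndromeM (ketbraBB R jN).
by rewrite linearN linearD.
Qed.

Lemma sum_ord_dimN (V : nmodType) (F : nat -> V) :
  \sum_(l < N) F l = F 0%N + \sum_(1 <= l < N) F l.
Proof. by rewrite -(big_mkord xpredT) big_ltn ?dimN_gt0. Qed.

Lemma sum_delta (V : lmodType (Cx R)) j (F : nat -> V) : (0 < j < N)%N ->
  \sum_(1 <= l < N) (l == j)%:R *: F l = F j.
Proof.
move=> jN; rewrite (bigD1_seq j) ?mem_index_iota ?iota_uniq //= eqxx scale1r.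
by rewrite big1 ?addr0// => l /negbTE ->; rewrite scale0r.
Qed.

(** The sum of [P l - P 0] carries [N - 1] copies of [P 0]; one more is missing from the
    completeness relation. *)
Lemma sum_Aop_Bop : \sum_(1 <= l < N) A l *m B l = 1%:M - N%:R *: P 0%N.
Proof.
rewrite (eq_big_nat _ _ (fun l lN => Aop_Bop lN)) sumrB sumr_const_nat.
have <- : \sum_(l < N) P l = 1%:M by rewrite /proj_syndrome -linear_sum /= sum_ketbra on_syndrome1.
rewrite sum_ord_dimN -scaler_nat [P 0%N + _]addrC -addrA; congr (_ + _).
by rewrite natrB ?dimN_gt0// scalerBl scale1r opprB.
Qed.

(** For [j > 0] and [l] different from 0 and [j], the [A l] parts cancel and [(2 / sN) *: A j]
    remains; [l = 0] gives the same. The diagonal coefficient [2 (1 - N) / sqrt N] removes these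
    [N - 1] copies, leaving only the [B j] of [H_{j,N+j}]. *)
Lemma sum_Hrow j : (j < N)%N ->
  \sum_(l < N) (Hdiag R n k j l + Hoff R n k j l) = (sN / 2) *: B j.
Proof.
move=> jN; rewrite (sum_ord_dimN (fun l => Hdiag R n k j l + Hoff R n k j l)).
have [->|j0] := posnP j.
  rewrite Bop0 scaler0 /Hdiag /Hoff /= addr0 scaleNr.
  apply/eqP; rewrite addrC subr_eq0 scaler_sumr; apply/eqP/eq_big_nat => l /andP[l0 _].
  by rewrite (gtn_eqF l0) addr0.
have s0 := sqrtN_neq0 R n k.
(* Excess of the term [l = j] over the generic term [(2 / sN) *: A j]. *)
pose X := (2 * (1 - N%:R) / sN) *: A j + (sN / 2) *: B j - (2 / sN) *: A j.
have -> : \sum_(1 <= l < N) (Hdiag R n k j l + Hoff R n k j l)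
    = \sum_(1 <= l < N) ((2 / sN) *: A j + (l == j)%:R *: X).
  apply: eq_big_nat => l /andP[l0 lN].
  rewrite /Hdiag /Hoff (gtn_eqF j0) (gtn_eqF l0) /= [l == j]eq_sym.
  case: eqP => [_|_].
    rewrite scale1r /X; move: (A j) (B j) (N%:R : Cx R) => a b nu.
    by apply/matrixP => u v; rewrite !mxE; field.
  rewrite scale0r addr0; move: (A j) (A l) => a b.
  by apply/matrixP => u v; rewrite !mxE; field.
rewrite big_split /= sumr_const_nat (sum_delta (fun=> X)) ?j0// -scaler_nat.
rewrite /Hdiag /Hoff (gtn_eqF j0) /= addr0 natrB ?dimN_gt0//.
rewrite /X; move: (A j) (B j) (N%:R : Cx R) => a b nu.
by apply/matrixP => u v; rewrite !mxE; field.
Qed.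

(** Closed form of [g_j], and of [g_{N+j}] too: minus one half of it is the eps^2 coefficient of
    [sqrt (2N) M_j]. *)
Definition second_row (j : nat) : 'M[Cx R]_(dimS n k) :=
  if j == 0%N then 1%:M - N%:R *: P 0%N
  else 1%:M + (N%:R / 4) *: P 0%N - (3 * N%:R / 4) *: P j.

(** The minus sign reflects [h_{N+l} = - h_l]. With it the [A j] parts cancel in the generic terms,
    each of which becomes [A l *m B l]; for [j > 0], [Y] corrects the term [l = j]. *)
Lemma sum_Hrow2 j : (j < N)%N ->
  \sum_(l < N) (Hdiag R n k j l - Hoff R n k j l) *m ((sN / 2) *: B l) = second_row j.
Proof.
move=> jN; have s0 := sqrtN_neq0 R n k.
pose F l := (Hdiag R n k j l - Hoff R n k j l) *m ((sN / 2) *: B l).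
have F0 : F 0%N = 0 by rewrite /F Bop0 scaler0 mulmx0.
rewrite (sum_ord_dimN F) F0 add0r {F0}/F.
have [->|j0] := posnP j.
  rewrite /second_row eqxx -sum_Aop_Bop; apply: eq_big_nat => l /andP[l0 _].
  rewrite /Hdiag /Hoff /= (gtn_eqF l0) subr0 -scalemxAl -scalemxAr scalerA.
  by rewrite (_ : 2 / sN * _ = 1) ?scale1r//; field.
pose Y := (- (2 * N%:R / sN)) *: A j - (sN / 2) *: B j.
have -> : \sum_(1 <= l < N) (Hdiag R n k j l - Hoff R n k j l) *m ((sN / 2) *: B l)
    = \sum_(1 <= l < N) (A l *m B l + (l == j)%:R *: (Y *m ((sN / 2) *: B l))).
  apply: eq_big_nat => l /andP[l0 lN].
  have -> : A l *m B l = (2 / sN) *: A l *m ((sN / 2) *: B l).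
    rewrite -scalemxAl -scalemxAr scalerA.
    by rewrite (_ : 2 / sN * _ = 1) ?scale1r//; field.
  rewrite scalemxAl -mulmxDl; congr (_ *m _).
  rewrite /Hdiag /Hoff (gtn_eqF j0) (gtn_eqF l0) /= [l == j]eq_sym.
  case: eqP => [<-|_].
    rewrite scale1r /Y; move: (A j) (B j) (N%:R : Cx R) => a b nu.
    by apply/matrixP => u v; rewrite !mxE; field.
  rewrite scale0r addr0; move: (A j) (A l) => a b.
  by apply/matrixP => u v; rewrite !mxE; field.
rewrite big_split /= (sum_delta (fun l => Y *m ((sN / 2) *: B l))) ?j0// sum_Aop_Bop.
have -> : Y *m ((sN / 2) *: B j) = - (N%:R *: (P j - P 0%N)) + (N%:R / 4) *: (P 0%N + P j).
  rewrite -(Aop_Bop (j := j)) ?j0// -[P 0%N + _]opprK -(Bop_sqr (j := j)) ?j0//.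
  rewrite /Y -(sqrtN_sqr R n k) mulmxBl -!scalemxAl -!scalemxAr.
  move: (A j *m B j) (B j *m B j) sN s0 => a b s s0.
  by apply/matrixP => u v; rewrite !mxE; field.
rewrite /second_row (gtn_eqF j0); move: (P j) (P 0%N) (N%:R : Cx R) => p q nu.
by apply/matrixP => u v; rewrite !mxE; field.
Qed.

Lemma Hop_dd j l : (j < N)%N -> (l < N)%N -> Hop R n k j l = Hdiag R n k j l.
Proof. by rewrite /Hop => -> ->. Qed.

Lemma Hop_do j l : (j < N)%N -> Hop R n k j (N + l) = Hoff R n k j l.
Proof. by rewrite /Hop => ->; rewrite ltnNge leq_addr /= addKn. Qed.

Lemma Hop_od j l : (l < N)%N -> Hop R n k (N + j) l = - Hoff R n k j l.
Proof. by rewrite /Hop => ->; rewrite ltnNge leq_addr /= addKn. Qed.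

Lemma Hop_oo j l : Hop R n k (N + j) (N + l) = - Hdiag R n k j l.
Proof. by rewrite /Hop !ltnNge !leq_addr /= !addKn. Qed.

Definition first_row (j : nat) : 'M[Cx R]_(dimS n k) :=
  if (j < N)%N then (sN / 2) *: B j else - ((sN / 2) *: B (j - N)%N).

Lemma first_row_lt j : (j < N)%N -> first_row j = (sN / 2) *: B j.
Proof. by rewrite /first_row => ->. Qed.

Lemma first_row_ge j : first_row (N + j) = - ((sN / 2) *: B j).
Proof. by rewrite /first_row ltnNge leq_addr /= addKn. Qed.

Lemma sum_Hop j : (j < 2 * N)%N -> \sum_(l < 2 * N) Hop R n k j l = first_row j.
Proof.
move: j; apply: dimN2_ind => j jN; rewrite (big_ord_dimN2 n k (Hop R n k _)).
  rewrite (first_row_lt jN) -(sum_Hrow jN); apply: eq_bigr => l _.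
  by rewrite (Hop_dd jN (ltn_ord l)) (Hop_do _ jN).
rewrite first_row_ge -(sum_Hrow jN) -sumrN; apply: eq_bigr => l _.
by rewrite (Hop_od _ (ltn_ord l)) Hop_oo opprD addrC.
Qed.

Lemma sum_Hop_first_row j : (j < N)%N ->
  \sum_(l < 2 * N) Hop R n k j l *m first_row l = second_row j
  /\ \sum_(l < 2 * N) Hop R n k (N + j) l *m first_row l = second_row j.
Proof.
move=> jN; split; rewrite (big_ord_dimN2 n k (fun l => Hop R n k _ l *m first_row l)).
  rewrite -(sum_Hrow2 jN); apply: eq_bigr => l _.
  by rewrite (Hop_dd jN (ltn_ord l)) (Hop_do _ jN) first_row_ge (first_row_lt (ltn_ord l)) mulmxN mulmxBl.
rewrite -(sum_Hrow2 jN); apply: eq_bigr => l _.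
rewrite (Hop_od _ (ltn_ord l)) Hop_oo first_row_ge (first_row_lt (ltn_ord l)).
rewrite mulmxN !mulNmx opprK.
by rewrite mulmxBl addrC.
Qed.

End Hamiltonian.

(** * The interaction Hamiltonian *)

Section AdjointScale.
Variables (C : numClosedFieldType) (d : nat) (c : C) (X Y : 'M[C]_d).
Hypotheses (hc : c^* = c) (hX : X ^t* = X) (hY : Y ^t* = Y).

Lemma adjmx_scale_add : (c *: (X + Y)) ^t* = c *: (Y + X).
Proof. by rewrite adjmxZ adjmxD hc hX hY addrC. Qed.

Lemma adjmx_scale_sub : (c *: (X - Y)) ^t* = - (c *: (Y - X)).
Proof. by rewrite adjmxZ adjmxD adjmxN hc hX hY -scalerN opprB. Qed.

End AdjointScale.

Section HamiltonianM.
Variables (R : realType) (n k : nat).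
Notation N := (dimN n k).
Notation sN := (sqrtN R n k).
Notation A := (Aop R n k).
Notation B := (Bop R n k).

Lemma Hdiag_adj j l : (Hdiag R n k j l) ^t* = Hdiag R n k l j.
Proof.
have c1 : (2 / sN)^* = 2 / sN by rewrite fmorph_div /= conj_sqrtN rmorph_nat.
rewrite /Hdiag; case: (eqVneq j 0%N) => [j0|j0]; case: (eqVneq l 0%N) => [l0|l0].
- by rewrite adjmxZ rmorphN /= c1 adjmx_sum (eq_bigr _ (fun m _ => Aop_adj R n k m)).
- by rewrite adjmxZ c1 Aop_adj.
- by rewrite adjmxZ c1 Aop_adj.
have [<-|jl] := eqVneq j l.
  rewrite adjmxZ Aop_adj; congr (_ *: _).
  rewrite fmorph_div /= conj_sqrtN; congr (_ / _).
  by rewrite rmorphM rmorphB /= rmorph1 !rmorph_nat.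
by apply: adjmx_scale_add (Aop_adj _ _ _ _) (Aop_adj _ _ _ _); rewrite fmorphV /= conj_sqrtN.
Qed.

Lemma Hoff_adj j l : (Hoff R n k j l) ^t* = - Hoff R n k l j.
Proof.
rewrite /Hoff [(l == 0%N) || _]orbC.
case: ((j == 0%N) || (l == 0%N)); first by rewrite adjmx0 oppr0.
have [<-|jl] := eqVneq j l.
  by rewrite adjmxZ fmorph_div /= conj_sqrtN rmorph_nat Bop_adj scalerN.
by apply: adjmx_scale_sub (Aop_adj _ _ _ _) (Aop_adj _ _ _ _); rewrite fmorphV /= conj_sqrtN.
Qed.

Lemma Hop_adj j l : (j < 2 * N)%N -> (l < 2 * N)%N ->
  (Hop R n k j l) ^t* = Hop R n k l j.
Proof.
move=> jN lN; move: j jN l lN; apply: dimN2_ind => j jN; apply: dimN2_ind => l lN.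
- by rewrite (Hop_dd R jN lN) (Hop_dd R lN jN) Hdiag_adj.
- by rewrite (@Hop_do R n k _ _ jN) (@Hop_od R n k _ _ jN) Hoff_adj.
- by rewrite (@Hop_od R n k _ _ lN) (@Hop_do R n k _ _ lN) adjmxN Hoff_adj opprK.
- by rewrite !Hop_oo adjmxN Hdiag_adj.
Qed.

Lemma HMop_hermitian : HMop R n k \is hermsymmx.
Proof.
apply/hermsymmxP; rewrite /HMop adjmx_sum exchange_big /=.
apply: eq_bigr => j _; rewrite adjmx_sum; apply: eq_bigr => l _.
by rewrite adjmx_tens ketbra_adj (Hop_adj (ltn_ord j) (ltn_ord l)).
Qed.

(** A constant family [phi] produces the row sums [h_j], and the family [h_l psi] then produces the
    [g_j]. *)
Lemma HMop_apply (phi : nat -> 'cV[Cx R]_(dimS n k)) :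
  HMop R n k *m \sum_(m < 2 * N) phi m *t ket R (dimA n k) m
  = \sum_(j < 2 * N) (\sum_(l < 2 * N) Hop R n k j l *m phi l) *t ket R (dimA n k) j.
Proof.
rewrite /HMop mulmx_suml; apply: eq_bigr => j _.
rewrite mulmx_suml tensmx_suml; apply: eq_bigr => l _.
have term (m : 'I_(2 * N)) : Hop R n k j l *t ketbra R (dimA n k) j l
      *m (phi m *t ket R (dimA n k) m)
    = ((l == m)%:R : Cx R) *: ((Hop R n k j l *m phi m) *t ket R (dimA n k) j).
  by rewrite tensmx_mul ketbra_ket ?dimA_eq// tensmxZr.
rewrite mulmx_sumr (eq_bigr _ (fun m _ => term m)) (bigD1 l)//= eqxx scale1r.
rewrite big1 ?addr0// => m /negbTE ml.
by rewrite eq_sym ml scale0r.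
Qed.

End HamiltonianM.

Section ExpandsMore.
Variable R : realType.

Lemma expandsMr p q t (f : R -> 'M[Cx R]_(p, q)) (F0 F1 F2 : 'M[Cx R]_(p, q))
    (W : 'M[Cx R]_(q, t)) :
  expands f F0 F1 F2 -> expands (fun e => f e *m W) (F0 *m W) (F1 *m W) (F2 *m W).
Proof.
move=> hf; have := expandsM hf (expands_taylor2 W 0 0).
rewrite !mulmx0 !add0r; apply: expands_near; apply: nearW => e.
by rewrite /taylor2 !scaler0 !addr0.
Qed.

Lemma mx_norm_tens (C : numClosedFieldType) m p q t (X : 'M[C]_(m, p)) (Y : 'M[C]_(q, t)) :
  `|X *t Y| <= `|X| * `|Y|.
Proof.
apply: mx_norm_ler => [|i j]; first by rewrite mulr_ge0.
by rewrite mxE normrM ler_pM ?ler_mx_norm_entry.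
Qed.

Lemma expands_tensr p q m t (f : R -> 'M[Cx R]_(p, q)) (F0 F1 F2 : 'M[Cx R]_(p, q))
    (Y : 'M[Cx R]_(m, t)) :
  expands f F0 F1 F2 -> expands (fun e => f e *t Y) (F0 *t Y) (F1 *t Y) (F2 *t Y).
Proof.
move=> [c c0 hc]; have [y y0 Yy] := mx_norm_toC Y.
exists (c * y); first exact: mulr_ge0.
apply: filterS hc => e hc.
have -> : f e *t Y - taylor2 (F0 *t Y) (F1 *t Y) (F2 *t Y) e
    = (f e - taylor2 F0 F1 F2 e) *t Y.
  rewrite tensmxDl tensNmx; congr (_ - _).
  by rewrite /taylor2 (tensmxDl (F0 + _)) (tensmxDl F0) (tensmxZl _ F1) (tensmxZl _ F2).
rewrite (le_trans (mx_norm_tens _ _))// Yy mulrAC rmorphM ler_wpM2r//.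
by rewrite toC_ge0.
Qed.

End ExpandsMore.

(** * Expansions for the recovery protocol *)

Section KrausPolar.
Variables (R : realType) (n k : nat).
Notation N := (dimN n k).
Notation sN := (sqrtN R n k).
Notation A := (Aop R n k).
Notation B := (Bop R n k).
Notation Q := (Rop R n k).
Notation P := (proj_syndrome R n k).
Notation HC := (HCop R n k).
Notation al := (kraus_scale R n k).
Notation g := (second_row R n k).

Lemma expands_eq p q (f : R -> 'M[Cx R]_(p, q)) (F0 F1 F2 G0 G1 G2 : 'M[Cx R]_(p, q)) :
  F0 = G0 -> F1 = G1 -> F2 = G2 -> expands f F0 F1 F2 -> expands f G0 G1 G2.
Proof. by move=> -> -> ->. Qed.

Lemma Rop_addC j : Q j + (Q j) ^t* = A j.
Proof. by rewrite Rop_adj /Aop linearD. Qed.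

Lemma Rop_subC j : Q j - (Q j) ^t* = B j.
Proof. by rewrite Rop_adj /Bop linearB. Qed.

Lemma Rop_mulC j : (j < N)%N -> Q j *m (Q j) ^t* = P 0%N.
Proof. by move=> jN; rewrite Rop_adj -on_syndromeM ketbraM// eqxx scale1r. Qed.

Lemma RopC_mul j : (Q j) ^t* *m Q j = P j.
Proof. by rewrite Rop_adj -on_syndromeM ketbraM ?dimN_gt0// scale1r. Qed.

Lemma HCopE j : HC j = (sN / 2) *: A j.
Proof. by rewrite /HCop linearZ. Qed.

Lemma HCop_sqr j : (0 < j < N)%N -> HC j *m HC j = (N%:R / 4) *: (P 0%N + P j).
Proof.
move=> jN.
have AA : A j *m A j = P 0%N + P j by rewrite /Aop -on_syndromeM (ketbraAA R jN) linearD.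
rewrite HCopE -scalemxAl -scalemxAr AA scalerA -(sqrtN_sqr R n k); congr (_ *: _).
by field.
Qed.

Lemma Aop0 : A 0%N = 2 *: P 0%N.
Proof. by rewrite /Aop linearD /= scaler_nat mulr2n. Qed.

Lemma HCop0 : HC 0%N = sN *: P 0%N.
Proof. by rewrite HCopE Aop0 scalerA; congr (_ *: _); field. Qed.

Lemma HCop0_sqr : HC 0%N *m HC 0%N = N%:R *: P 0%N.
Proof.
rewrite HCop0 -scalemxAl -scalemxAr.
have -> : P 0%N *m P 0%N = P 0%N by exact: Rop0_idempotent.
by rewrite scalerA -(sqrtN_sqr R n k) expr2.
Qed.

(** Only the first-order coefficients see the sign [s]. The second-order coefficient of [U] is put
    in the form [- HC^2 / 2], ready for comparison with the exponential. *)
Lemma expands_polar_Kop_sgn (s : Cx R) j (U M : R -> 'M[Cx R]_(dimS n k)) :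
  s^* = s -> s * s = 1 -> (j < N)%N ->
  (\forall e \near 0^'+, polar_decomposition (Kop_sgn n k s e j) (U e) (M e)) ->
  expands M (toC al)%:M ((s * imC R * toC al) *: ((sN / 2) *: B j))
    (- ((toC al / 2) *: g j))
  /\ expands U 1%:M (s *: (imC R *: HC j)) (- (2^-1 *: (HC j *m HC j))).
Proof.
move=> hs ss jN pol; have hK := expands_Kop_sgn n k s j.
pose z : Cx R := s * imC R * sN.
have hz : z^* = - z.
  by rewrite !rmorphM /= hs conj_imC conj_sqrtN mulrN mulNr.
have zz : z ^+ 2 = - N%:R.
  by rewrite 2!exprMn imC_sqr sqrtN_sqr expr2 ss mul1r mulN1r.
have [j0|j0] := posnP j.
  move: pol hK; rewrite j0 => pol hK.
  have idQ := Rop0_idempotent R n k.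
  have hQ : (Q 0%N) ^t* = Q 0%N by exact: Rop_adj.
  have [hM hU] := expands_polar_projector (kraus_scale_gt0 R n k) hz idQ hQ pol hK.
  split.
    apply: (expands_eq (erefl _) _ _ hM); first by rewrite Bop0 !scaler0.
    rewrite /second_row eqxx zz.
    have -> : P 0%N = Q 0%N by [].
    move: (Q 0%N) (N%:R : Cx R) (toC al) => q nu a.
    by apply/matrixP => u v; rewrite !mxE; field.
  apply: (expands_eq (erefl _) _ _ hU).
    by rewrite HCop0 !scalerA; congr (_ *: _); rewrite /z; ring.
  by rewrite HCop0_sqr zz scalerA -scaleNr; congr (_ *: _); field.
have jN' : (0 < j < N)%N by rewrite j0.
have [] := expands_polar_nilpotent (kraus_scale_gt0 R n k) hz (Rop_nilpotent R jN') pol hK.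
rewrite Rop_addC Rop_subC (Rop_mulC jN) RopC_mul zz => hM hU; split.
  apply: (expands_eq (erefl _) _ _ hM).
    by rewrite scalerA; congr (_ *: _); rewrite /z; ring.
  rewrite /second_row (gtn_eqF j0); move: (P j) (P 0%N) (N%:R : Cx R) (toC al) => p q nu a.
  by apply/matrixP => u v; rewrite !mxE; field.
apply: (expands_eq (erefl _) _ _ hU).
  by rewrite HCopE !scalerA; congr (_ *: _); rewrite /z; ring.
by rewrite (HCop_sqr jN') scalerA -scaleNr; congr (_ *: _); field.
Qed.

(** The vanishing linear term is written so as to agree literally with [expands_polar_Kop_sgn] at
    [s = 1]. *)
Lemma expands_Mapprox0 : expands (@Mapprox0 R n k) (toC al)%:M
  ((1 * imC R * toC al) *: ((sN / 2) *: B 0%N)) (- ((toC al / 2) *: g 0%N)).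
Proof.
apply: expands_near (expands_taylor2 _ _ _); apply: nearW => e.
rewrite /taylor2 Bop0 !scaler0 addr0 /Mapprox0 -toC_kraus_scale linearD !linearZ /=.
rewrite on_syndrome1 /second_row eqxx -/(P 0%N).
move: (P 0%N) (N%:R : Cx R) (toC al) (toC e) => p nu a x.
by apply/matrixP => u v; rewrite !mxE; field.
Qed.

Lemma expands_Mapprox_sgn (s : Cx R) j : (0 < j)%N ->
  expands (fun e => Mapprox_sgn n k s e j) (toC al)%:M
    ((s * imC R * toC al) *: ((sN / 2) *: B j)) (- ((toC al / 2) *: g j)).
Proof.
move=> j0; apply: expands_near (expands_taylor2 _ _ _); apply: nearW => e.
rewrite /taylor2 /Mapprox_sgn -toC_kraus_scale.
have osD (X Y : 'M[Cx R]_N) : on_syndrome (X + Y) = on_syndrome X + on_syndrome Y.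
  exact: linearD.
have osB (X Y : 'M[Cx R]_N) : on_syndrome (X - Y) = on_syndrome X - on_syndrome Y.
  exact: linearB.
have osZ c (X : 'M[Cx R]_N) : on_syndrome (c *: X) = c *: on_syndrome X.
  exact: linearZ.
rewrite (osD (_ + _)) (osD (_ - _)) (osB (_ *: _)) !osZ on_syndrome1.
rewrite -/(P 0%N) -/(P j) -/(B j) /second_row (gtn_eqF j0).
move: (P 0%N) (P j) (B j) (N%:R : Cx R) (toC al) (toC e) => p q b nu a x.
by apply/matrixP => u v; rewrite !mxE; field.
Qed.

End KrausPolar.

(** * Comparison of the ancilla protocol with the measured states *)

Section WeakProtocol.
Variables (R : realType) (n k : nat).
Notation N := (dimN n k).
Notation sN := (sqrtN R n k).
Notation al := (kraus_scale R n k).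

Lemma expands_polar_Kop (U M : R -> nat -> 'M[Cx R]_(dimS n k)) :
  (forall (e : R) j, 0 < e < 1 -> (j < 2 * N)%N ->
     polar_decomposition (Kop n k e j) (U e j) (M e j)) ->
  forall j, (j < N)%N ->
  [/\ expands (M ^~ j) (toC al)%:M
        ((1 * imC R * toC al) *: ((sN / 2) *: Bop R n k j))
        (- ((toC al / 2) *: second_row R n k j)),
      expands (M ^~ (N + j)%N) (toC al)%:M
        ((-1 * imC R * toC al) *: ((sN / 2) *: Bop R n k j))
        (- ((toC al / 2) *: second_row R n k j)),
      expands (U ^~ j) 1%:M (1 *: (imC R *: HCop R n k j))
        (- (2^-1 *: (HCop R n k j *m HCop R n k j)))
    & expands (U ^~ (N + j)%N) 1%:M (-1 *: (imC R *: HCop R n k j))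
        (- (2^-1 *: (HCop R n k j *m HCop R n k j)))].
Proof.
move=> pol j jN.
have jN1 : (j < 2 * N)%N by rewrite mul2n -addnn ltn_addr.
have jN2 : (N + j < 2 * N)%N by rewrite mul2n -addnn ltn_add2l.
have conj1 : (1 : Cx R)^* = 1 by rewrite rmorph1.
have conjN1 : (-1 : Cx R)^* = -1 by rewrite rmorphN rmorph1.
have sqrN1 : (-1 : Cx R) * -1 = 1 by rewrite mulrNN mulr1.
have pol1 : \forall e \near (0 : R)^'+,
    polar_decomposition (Kop_sgn n k 1 e j) (U e j) (M e j).
  by apply: filterS (near0_itv R) => e he; rewrite -(Kop_lt e jN); exact: pol.
have pol2 : \forall e \near (0 : R)^'+,
    polar_decomposition (Kop_sgn n k (-1) e j) (U e (N + j)%N) (M e (N + j)%N).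
  by apply: filterS (near0_itv R) => e he; rewrite -(Kop_ge n k e j); exact: pol.
have [hM1 hU1] := expands_polar_Kop_sgn conj1 (mulr1 1) jN pol1.
have [hM2 hU2] := expands_polar_Kop_sgn conjN1 sqrN1 jN pol2.
exact: And4 hM1 hM2 hU1 hU2.
Qed.

Lemma expands_weak_measurement (psi : 'cV[Cx R]_(dimS n k)) :
  expands (fun e => expi e (HMop R n k) *m (psi *t ancilla0 R n k))
    (\sum_(j < 2 * N) ((toC al)%:M *m psi) *t ket R (dimA n k) j)
    (\sum_(j < 2 * N) (((imC R * toC al) *: first_row R n k j) *m psi)
       *t ket R (dimA n k) j)
    (\sum_(j < 2 * N) ((- ((toC al / 2) *:
         \sum_(l < 2 * N) Hop R n k j l *m first_row R n k l)) *m psi)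
       *t ket R (dimA n k) j).
Proof.
have init : psi *t ancilla0 R n k
    = toC al *: \sum_(j < 2 * N) psi *t ket R (dimA n k) j.
  by rewrite ancilla0E tensmxZr tensmx_sumr toC_kraus_scale.
have apply1 : HMop R n k *m (psi *t ancilla0 R n k)
    = toC al *: \sum_(j < 2 * N) (first_row R n k j *m psi) *t ket R (dimA n k) j.
  rewrite init -scalemxAr (HMop_apply (fun=> psi)); congr (_ *: _).
  by apply: eq_bigr => j _; rewrite -mulmx_suml (sum_Hop R (ltn_ord j)).
have apply2 : HMop R n k *m HMop R n k *m (psi *t ancilla0 R n k)
    = toC al *: \sum_(j < 2 * N)
        ((\sum_(l < 2 * N) Hop R n k j l *m first_row R n k l) *m psi)
          *t ket R (dimA n k) j.
  rewrite -mulmxA apply1 -scalemxAr (HMop_apply (fun j => first_row R n k j *m psi)).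
  congr (_ *: _); apply: eq_bigr => j _; rewrite mulmx_suml.
  by congr (_ *t _); apply: eq_bigr => l _; rewrite mulmxA.
apply: (expands_eq _ _ _ (expandsMr (psi *t ancilla0 R n k) (expands_expi (HMop R n k)))).
- rewrite mul1mx init scaler_sumr; apply: eq_bigr => j _.
  by rewrite mul_scalar_mx tensmxZl.
- rewrite -scalemxAl apply1 scalerA scaler_sumr; apply: eq_bigr => j _.
  by rewrite -scalemxAl tensmxZl.
rewrite mulNmx -scalemxAl apply2 scalerA -scaleNr scaler_sumr; apply: eq_bigr => j _.
by rewrite mulNmx -scalemxAl -scaleNr tensmxZl mulrC.
Qed.

Lemma expands_measured_states (U M : R -> nat -> 'M[Cx R]_(dimS n k))
    (psi : 'cV[Cx R]_(dimS n k)) :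
  (forall (e : R) j, 0 < e < 1 -> (j < 2 * N)%N ->
     polar_decomposition (Kop n k e j) (U e j) (M e j)) ->
  expands (fun e => \sum_(j < 2 * N) (M e j *m psi) *t ket R (dimA n k) j)
    (\sum_(j < 2 * N) ((toC al)%:M *m psi) *t ket R (dimA n k) j)
    (\sum_(j < 2 * N) (((imC R * toC al) *: first_row R n k j) *m psi)
       *t ket R (dimA n k) j)
    (\sum_(j < 2 * N) ((- ((toC al / 2) *:
         \sum_(l < 2 * N) Hop R n k j l *m first_row R n k l)) *m psi)
       *t ket R (dimA n k) j).
Proof.
move=> pol.
have hM j : (j < 2 * N)%N -> expands (M ^~ j) (toC al)%:M
    ((imC R * toC al) *: first_row R n k j)
    (- ((toC al / 2) *: \sum_(l < 2 * N) Hop R n k j l *m first_row R n k l)).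
  move: j; apply: dimN2_ind => j jN; have [h1 h2 _ _] := expands_polar_Kop pol jN;
    have [g1 g2] := sum_Hop_first_row R jN.
    by apply: (expands_eq (erefl _) _ _ h1); rewrite ?g1// (first_row_lt R jN) mul1r.
  by apply: (expands_eq (erefl _) _ _ h2); rewrite ?g2// first_row_ge mulN1r mulNr scaleNr scalerN.
by apply: expands_sum => j; exact: expands_tensr (expandsMr _ (hM _ (ltn_ord j))).
Qed.

End WeakProtocol.

Theorem mainTheorem2 (R : realType) (n k : nat) (hkn : (k < n)%N) :
  let N := dimN n k in
  (forall eps : R, 0 < eps < 1 ->
     kraus_operators (2 * N)%N (Kop n k eps) (recovery_map eps))
  /\ (forall (eps : R) (j : nat), 0 < eps < 1 -> (j < 2 * N)%N ->
        exists! UM : 'M[Cx R]_(dimS n k) * 'M[Cx R]_(dimS n k),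
          polar_decomposition (Kop n k eps j) UM.1 UM.2)
  /\ HMop R n k \is hermsymmx
  /\ (forall UC M : R -> nat -> 'M[Cx R]_(dimS n k),
        (forall (eps : R) (j : nat), 0 < eps < 1 -> (j < 2 * N)%N ->
           polar_decomposition (Kop n k eps j) (UC eps j) (M eps j)) ->
        [/\ eq_2nd_order (fun eps => M eps 0%N) (fun eps => Mapprox0 n k eps)
            /\ eq_2nd_order (fun eps => M eps N) (fun eps => Mapprox0 n k eps),
            forall j : nat, (1 <= j < N)%N ->
              eq_2nd_order (fun eps => M eps j)
                           (fun eps => Mapprox_sgn n k 1 eps j)
              /\ eq_2nd_order (fun eps => M eps (N + j)%N)
                              (fun eps => Mapprox_sgn n k (-1) eps j),
            forall j : nat, (j < N)%N ->
              eq_2nd_order (fun eps => UC eps j)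
                           (fun eps => expi eps (HCop R n k j))
              /\ eq_2nd_order (fun eps => UC eps (N + j)%N)
                              (fun eps => expi (- eps) (HCop R n k j))
          & forall psi : 'cV[Cx R]_(dimS n k),
              eq_2nd_order
                (fun eps => expi eps (HMop R n k) *m (psi *t ancilla0 R n k))
                (fun eps => \sum_(j < (2 * N)%N)
                              (M eps j *m psi) *t ket R (dimA n k) j)]).
Proof.
move=> N; split; first exact: kraus_operators_Kop.
split.
  move=> eps j he jN; apply: polar_decomposition_exists_unique.
  exact: Kop_unitmx.
split; first exact: HMop_hermitian.
move=> UC M pol; have hpol := expands_polar_Kop pol.
split.
- have [h1 h2 _ _] := hpol 0%N (dimN_gt0 n k).
  split; first exact: expands_eq_2nd_order h1 (expands_Mapprox0 R n k).
  rewrite addn0 in h2; apply: expands_eq_2nd_order h2 _.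
  (* The linear coefficient expected for [M_N] carries the opposite sign, which is immaterial
     because [B 0] is zero. *)
  have := expands_Mapprox0 R n k; rewrite Bop0 !scaler0; exact.
- move=> j /andP[j0 jN]; have [h1 h2 _ _] := hpol j jN.
  by split; [exact: expands_eq_2nd_order h1 (expands_Mapprox_sgn _ _ _ j0)
            |exact: expands_eq_2nd_order h2 (expands_Mapprox_sgn _ _ _ j0)].
- move=> j jN; have [_ _ h1 h2] := hpol j jN.
  split.
    rewrite scale1r in h1.
    exact: expands_eq_2nd_order h1 (expands_expi _).
  rewrite scaleN1r in h2.
  exact: expands_eq_2nd_order h2 (expands_expiN _).
move=> psi.
exact: expands_eq_2nd_order (expands_weak_measurement psi) (expands_measured_states psi pol).
Qed.
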